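(* There are universal constants $c_0,c_1>0$ such that for every $h>0$ and every $\varepsilon\in(0,c_1h]$ the following holds. Consider any (possibly randomized) learner that receives $m$ independent samples from $D_B$ and $m$ independent samples from $D_S$ and that, for every regular product distribution $D=D_B\times D_S$ on $[0,h]^2$, outputs with probability at least $2/3$ a mechanism $M$ that is BIC, IIR and ex-ante WBB under $D$ and satisfies $\mathrm{GFT}(M;D)\ge\mathrm{SB}(D)-\varepsilon$. Then \[ m\ \ge\ c_0\,\frac{h^2}{\varepsilon^2}. \]
   Context: **Bilateral trade.** A buyer has private value $b\sim D_B$ and a seller has private cost $s\sim D_S$, independently; $D=D_B\times D_S$ is supported on $[0,h]^2$. A direct mechanism $M=(q,x_B,x_S)$ on $[0,h]^2$ consists of a trade probability $q(b,s)\in[0,1]$, a payment $x_B(b,s)$ made by the buyer and a payment $x_S(b,s)$ made to the seller (measurable, integrable). Define $\mathrm{GFT}(M;D)=\mathbb E_D[q(b,s)(b-s)]$ and $\mathrm{Rev}(M;D)=\mathbb E_D[x_B(b,s)-x_S(b,s)]$. Under $D$, $M$ is BIC if for each true type in the support and each report in $[0,h]$ truthful reporting maximizes interim expected utility (buyer: $\mathbb E_{s\sim D_S}[b\,q(b',s)-x_B(b',s)]$ maximized at $b'=b$; seller: $\mathbb E_{b\sim D_B}[x_S(b,s')-s\,q(b,s')]$ maximized at $s'=s$); IIR if these truthful interim utilities are $\ge0$; ex-ante WBB if $\mathrm{Rev}(M;D)\ge0$. $M$ is feasible on $D$ if it is BIC, IIR and ex-ante WBB under $D$, and $\mathrm{SB}(D)=\sup\{\mathrm{GFT}(M;D):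 M \text{ feasible on } D\}$. **Regularity.** Marginals have cdfs $F_B,F_S$ and densities $f_B,f_S$ positive on the interiors of their (interval) supports. $D$ is regular if $\phi_B(b)=b-\frac{1-F_B(b)}{f_B(b)}$ and $\phi_S(s)=s+\frac{F_S(s)}{f_S(s)}$ are nondecreasing. *)

(* Defs.v *)
From HB Require Import structures.
From mathcomp Require Import all_boot all_order all_algebra.
From mathcomp Require Import all_classical all_reals all_analysis.
Set Implicit Arguments.
Unset Strict Implicit.
Unset Printing Implicit Defensive.
Import Order.TTheory GRing.Theory Num.Theory.
Import numFieldNormedType.Exports.
Local Open Scope classical_set_scope.
Local Open Scope ring_scope.

Section iid.
Context d (T : measurableType d) (R : realType) (mu : probability T R).

Definition tuple_cons n (z : T * n.-tuple T) : n.+1.-tuple T :=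
  [tuple of z.1 :: z.2].

Lemma measurable_tuple_cons n : measurable_fun setT (@tuple_cons n).
Proof. exact: measurable_cons. Qed.

HB.instance Definition _ n :=
  isMeasurableFun.Build _ _ _ _ (@tuple_cons n) (@measurable_tuple_cons n).

Fixpoint iid_law (n : nat) : probability (n.-tuple T) R :=
  match n with
  | 0%N => dirac [tuple]
  | n'.+1 => distribution (mu \x iid_law n')%E (@tuple_cons n')
  end.

End iid.

Section distributions.
Context {R : realType}.
Implicit Types (mu : probability (measurableTypeR R) R) (f : R -> R).

(* The topological support; it is a closed set, so an interval support keeps
   its endpoints. *)
Definition msupport mu : set R :=
  [set x | forall U : set R, open U -> U x -> (0 < mu U)%E].

Definition idTR : measurableTypeR R -> R := idfun.

HB.instance Definition _ :=
  @isMeasurableFun.Build _ _ _ _ idTR (@measurable_id _ _ setT).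

Definition cdf_of mu (x : R) : R := fine (cdf (idTR : {RV mu >-> R}) x).

Lemma cdf_ofE mu x : cdf_of mu x = fine (mu `]-oo, x]%classic).
Proof. by []. Qed.

Definition is_density mu f : Prop :=
  [/\ measurable_fun setT f, (forall x, 0 <= f x) &
      forall A : set R, measurable A ->
        mu A = (\int[lebesgue_measure]_(x in A) (f x)%:E)%E].

Definition admissible (h : R) mu f : Prop :=
  [/\ mu `[0, h]%classic = 1%E, is_interval (msupport mu), is_density mu f &
      forall x, (msupport mu)^° x -> 0 < f x].

Definition phiB mu f (b : R) : R := b - (1 - cdf_of mu b) / f b.
Definition phiS mu f (s : R) : R := s + cdf_of mu s / f s.

(* The virtual types are compared on the interior of the support only: the
   density may vanish at the endpoints, where the quotient is undefined. *)
Definition nondecreasing_inside mu (phi : R -> R) : Prop :=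
  forall x y : R, (msupport mu)^° x -> (msupport mu)^° y -> x <= y -> phi x <= phi y.

Definition regular (h : R) (DB DS : probability (measurableTypeR R) R) : Prop :=
  exists fB fS : R -> R,
    [/\ admissible h DB fB, admissible h DS fS,
        nondecreasing_inside DB (phiB DB fB) &
        nondecreasing_inside DS (phiS DS fS)].

End distributions.

Definition square {R : realType} (h : R) :
  set (measurableTypeR R * measurableTypeR R) :=
  `[0, h]%classic `*` `[0, h]%classic.

(* The first argument of each component is the buyer's report, the second one
   the seller's; values outside [0, h]^2 are irrelevant, and every expectation
   below is taken over [0, h]. *)
Record mechanism (R : realType) (h : R) := Mechanism {
  alloc : R -> R -> R;
  payB : R -> R -> R;
  payS : R -> R -> R;
  alloc_range : forall b s, 0 <= b <= h -> 0 <= s <= h -> 0 <= alloc b s <= 1;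
  alloc_measurable : measurable_fun (square h) (fun z => alloc z.1 z.2);
  payB_measurable : measurable_fun (square h) (fun z => payB z.1 z.2);
  payS_measurable : measurable_fun (square h) (fun z => payS z.1 z.2)
}.

Section trade.
Context {R : realType} (h : R) (DB DS : probability (measurableTypeR R) R).
Implicit Types M : mechanism h.

Definition GFT M : R :=
  \int[(DB \x DS)%E]_(z in square h) (alloc M z.1 z.2 * (z.1 - z.2)).

Definition Rev M : R :=
  \int[(DB \x DS)%E]_(z in square h) (payB M z.1 z.2 - payS M z.1 z.2).

(* Interim expectations are evaluated at every report, also at those in a
   null set, so their existence does not follow from integrability of the
   payments under the product measure. *)
Definition integrable_payments M : Prop :=
  [/\ (DB \x DS)%E.-integrable (square h) (fun z => (payB M z.1 z.2)%:E),
      (DB \x DS)%E.-integrable (square h) (fun z => (payS M z.1 z.2)%:E),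
      forall b, 0 <= b <= h -> DS.-integrable `[0, h]%classic (fun s => (payB M b s)%:E) &
      forall s, 0 <= s <= h -> DB.-integrable `[0, h]%classic (fun b => (payS M b s)%:E)].

Definition utilB M (b b' : R) : R :=
  \int[DS]_(s in `[0, h]%classic) (b * alloc M b' s - payB M b' s).

Definition utilS M (s s' : R) : R :=
  \int[DB]_(b in `[0, h]%classic) (payS M b s' - s * alloc M b s').

Definition BIC M : Prop :=
  (forall b b', msupport DB b -> 0 <= b' <= h -> utilB M b b' <= utilB M b b) /\
  (forall s s', msupport DS s -> 0 <= s' <= h -> utilS M s s' <= utilS M s s).

Definition IIR M : Prop :=
  (forall b, msupport DB b -> 0 <= utilB M b b) /\
  (forall s, msupport DS s -> 0 <= utilS M s s).

Definition exante_WBB M : Prop := 0 <= Rev M.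

Definition feasible M : Prop :=
  [/\ integrable_payments M, BIC M, IIR M & exante_WBB M].

Definition SB : \bar R := ereal_sup [set (GFT M)%:E | M in feasible].

Definition good (eps : R) M : Prop :=
  feasible M /\ (SB - eps%:E <= (GFT M)%:E)%E.

End trade.

(* The learner's random seed is a point of T. *)
Definition learner (T : Type) (R : realType) (m : nat) (h : R) :=
  m.-tuple (measurableTypeR R) -> m.-tuple (measurableTypeR R) -> T ->
  mechanism h.

(* The set of mechanisms carries no sigma-algebra and a learner is an arbitrary
   function, so that "with probability at least 2/3" is read as an inner
   probability; it is the probability of the event whenever the latter is
   measurable. *)
Definition succeeds d (T : measurableType d) (R : realType) (P : probability T R)
    (m : nat) (h eps : R) (L : learner T m h)
    (DB DS : probability (measurableTypeR R) R) : Prop :=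
  exists A : set (m.-tuple (measurableTypeR R) * m.-tuple (measurableTypeR R) * T),
    [/\ measurable A,
        A `<=` [set w | good DB DS eps (L w.1.1 w.1.2 w.2)] &
        ((2 / 3)%:E <= ((iid_law DB m \x iid_law DS m) \x P) A)%E].

(* Main.v *)
(* Two-point argument.  Let buyer and seller be uniform on [0, h]: trading iff
   b - s >= h / 4 is then second best, with zero revenue and gains from trade
   9 h / 64.  Tilt the buyer's density by 1 - d below h / 2 and by 1 + d above.
   The uniform optimum has revenue of order -d h under the tilted distribution,
   and the shadow price of the budget constraint is a positive constant, so by
   Lagrangian relaxation (the virtual surplus constraint of Myerson and
   Satterthwaite with multiplier 1/2) every mechanism feasible for the tilted
   distribution loses at least d h / 320 on the uniform one.  Hence for d of
   order eps / h no mechanism is feasible for the tilted distribution and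
   eps-optimal for the uniform one, and the learner tells the two apart.  The
   chi-squared divergence of m samples is (1 + d ^ 2) ^ m - 1, which forces
   m d ^ 2 >= 1 / 4. *)
Require Import Defs.
From HB Require Import structures.
From mathcomp Require Import all_boot all_order all_algebra.
From mathcomp Require Import all_classical all_reals all_analysis measurable_realfun.
From mathcomp Require Import ring lra.
Set Implicit Arguments.
Unset Strict Implicit.
Unset Printing Implicit Defensive.
Import Order.TTheory GRing.Theory Num.Theory.
Import numFieldNormedType.Exports.
Local Open Scope classical_set_scope.
Local Open Scope ring_scope.

(** The objective and the constraint live under different laws: gains from trade are measured under
    the uniform law, feasibility under the tilted one. The uniform second best therefore enters only
    through a lower bound, witnessed by one explicit mechanism. As the objective does not move with
    d, the loss comes wholly from the constraint: to first order it is the multiplier times the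
    deficit d h / 96 of the wedge rule under the tilt, that is d h / 192, and the constant 320
    leaves room for the second-order terms.

    The multiplier 1/2 comes from the untilted problem: with multiplier l the integrand is (1 + 2
    l)(b - s) - l h, which changes sign at b - s = h / 4 exactly for l = 1/2. The density jumps up,
    not down, at h / 2 because an upward jump also makes the buyer's virtual value jump up, which
    preserves regularity.

    The obstacle is that mechanisms are arbitrary: payments are merely integrable and interim
    utilities come with no regularity, so the payment formula has to be drawn from the incentive
    inequalities alone. *)

Section density.
Context {R : realType}.
Local Notation leb := (@lebesgue_measure R).
Implicit Types (mu : probability (measurableTypeR R) R) (f : R -> R).
Local Open Scope ereal_scope.

(** * Probability laws given by a density *)

Section build.
Variable f : R -> R.
Hypotheses (mf : measurable_fun setT f) (f0 : forall x, (0 <= f x)%R).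
Hypothesis f1 : \int[leb]_x (f x)%:E = 1.

Definition density_measure : set (measurableTypeR R) -> \bar R :=
  fun A => \int[leb]_(x in A) (f x)%:E.

Let density0 : density_measure set0 = 0.
Proof. by rewrite /density_measure integral_set0. Qed.

Let density_ge0 A : 0 <= density_measure A.
Proof. by apply: integral_ge0 => x _; rewrite lee_fin. Qed.

Let density_sigma_additive : semi_sigma_additive density_measure.
Proof.
move=> F mF tF mUF; rewrite /density_measure ge0_integral_bigcup//=.
- by apply/cvg_closeP; split; [apply: is_cvg_nneseries => n _ _; apply: integral_ge0 => x _; rewrite lee_fin|rewrite closeE].
- exact/measurable_EFinP/measurable_funTS.
- by move=> x _; rewrite lee_fin.
Qed.

HB.instance Definition _ := isMeasure.Build _ _ _ density_measure
  density0 density_ge0 density_sigma_additive.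

Let densityT : density_measure [set: _] = 1.
Proof. exact: f1. Qed.

HB.instance Definition _ :=
  Measure_isProbability.Build _ _ R density_measure densityT.

Lemma exists_density : exists mu, is_density mu f.
Proof. by exists density_measure. Qed.

End build.

Import HBNNSimple.

(** For indicators this is the definition of a density; simple functions follow by linearity,
    nonnegative measurable ones by monotone convergence on both sides. *)
Lemma ge0_integral_density mu f (g : R -> \bar R) : is_density mu f ->
  measurable_fun setT g -> (forall x, 0 <= g x) ->
  \int[mu]_x g x = \int[leb]_x (g x * (f x)%:E).
Proof.
move=> [mf f0 muE] mg g0.
have mfE : measurable_fun [set: measurableTypeR R] (EFin \o f) by exact/measurable_EFinP.
have muindicE (A : set R) : measurable A ->
    \int[mu]_x (\1_A x)%:E = \int[leb]_x ((\1_A x)%:E * (f x)%:E).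
  move=> mA; rewrite integral_indic// setIT [LHS]muE// integral_mkcond.
  apply: eq_integral => x _; rewrite patchE indicE.
  by case: ifP; rewrite ?mul1e ?mul0e.
have nnsfunE (k : {nnsfun measurableTypeR R >-> R}) :
    \int[mu]_x (k x)%:E = \int[leb]_x ((k x)%:E * (f x)%:E).
  under [LHS]eq_integral do rewrite fimfunE -fsumEFin//.
  rewrite [LHS]ge0_integral_fsum//; last 2 first.
    by move=> r; exact/measurable_EFinP/measurableT_comp.
    by move=> r x _; rewrite EFinM nnfun_muleindic_ge0.
  under [RHS]eq_integral => x _.
    rewrite fimfunE -fsumEFin// ge0_mule_fsuml; last first.
      by move=> r; rewrite EFinM nnfun_muleindic_ge0.
    over.
  rewrite [RHS]ge0_integral_fsum//; last 2 first.
    move=> r; apply: emeasurable_funM => //.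
    exact/measurable_EFinP/measurableT_comp.
    by move=> r x _; apply: mule_ge0; rewrite ?EFinM ?nnfun_muleindic_ge0 ?lee_fin.
  apply: eq_fsbigr => r _ /=.
  have [r0|r0] := ltP r 0%R.
    rewrite !integral0_eq// => x _; rewrite preimage_nnfun0//.
      by rewrite indic0 mulr0 mul0e.
    by rewrite indic0 mulr0.
  transitivity (\int[leb]_x (r%:E * ((\1_(k @^-1` [set r]) x)%:E * (f x)%:E))); last first.
    by apply: eq_integral => x _; rewrite muleA -EFinM.
  under eq_integral do rewrite EFinM.
  rewrite ge0_integralZl//; last exact/measurable_EFinP.
  rewrite ge0_integralZl//.
  - by rewrite muindicE// -[X in measurable X]setTI; exact: (measurable_funP k).
  - by apply: emeasurable_funM => //; exact/measurable_EFinP.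
  - by move=> x _; rewrite mule_ge0// lee_fin.
pose k := nnsfun_approx (@measurableT _ (measurableTypeR R)) mg.
transitivity (limn (fun n => \int[mu]_x (k n x)%:E)).
  rewrite -monotone_convergence//=.
  - by apply: eq_integral => x _; apply/esym/cvg_lim => //; exact: cvg_nnsfun_approx.
  - by move=> n; exact/measurable_EFinP.
  - by move=> n x _; rewrite lee_fin; exact: fun_ge0.
  - by move=> x _ a b ab; rewrite lee_fin; exact/lefP/nd_nnsfun_approx.
under eq_fun do rewrite nnsfunE.
rewrite -monotone_convergence//=.
- apply: eq_integral => x _; apply: cvg_lim => //.
  apply: cvgeZr => //; exact: cvg_nnsfun_approx.
- by move=> n; apply: emeasurable_funM => //; exact/measurable_EFinP.
- by move=> n x _; rewrite mule_ge0 ?lee_fin.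
- move=> x _ a b ab; rewrite lee_wpmul2r ?lee_fin//.
  exact/lefP/nd_nnsfun_approx.
Qed.

End density.

(** * Distinguishing two laws from samples: chi-squared bounds *)

Section testing.
Context {R : realType}.
Local Open Scope ereal_scope.

(* By AM-GM this is implied by [P1 E ^ 2 <= K * P0 E], which is Cauchy-Schwarz
   for a likelihood ratio of second moment [K]; the form below is linear in the
   two measures and therefore can be integrated. *)
Definition chi2_close d (T : measurableType d) (K : R)
    (P0 P1 : set T -> \bar R) : Prop :=
  forall (E : set T) (c : R), measurable E -> (0 <= c)%R ->
    (2 * c)%:E * P1 E <= P0 E + (c ^+ 2 * K)%:E.

(** Tensorisation by induction on [n]: given the first sample [x], the induction hypothesis is
    applied to the section of the event with [c * L x] in place of [c]. Integrating over [mu0] turns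
    [L x ^+ 2] into one more factor [K]. *)
Lemma chi2_close_iid d (T : measurableType d) (mu0 mu1 : probability T R)
    (L : T -> R) (K : R) (n : nat) :
  (0 <= K)%R -> measurable_fun setT L -> (forall x, (0 <= L x)%R) ->
  (forall g : T -> \bar R, measurable_fun setT g -> (forall x, 0 <= g x) ->
    \int[mu1]_x g x = \int[mu0]_x (g x * (L x)%:E)) ->
  \int[mu0]_x ((L x) ^+ 2)%:E = K%:E ->
  chi2_close (K ^+ n) (iid_law mu0 n) (iid_law mu1 n).
Proof.
move=> K0 mL L0 mu1E LK; elim: n => [|n IHn] E c mE c0 /=.
  rewrite diracE -EFinM -EFinD lee_fin; case: (_ \in _) => /=; last nra.
  by have := sqr_ge0 (c - 1); nra.
rewrite /distribution /pushforward /=.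
set E' := _ @^-1` E.
have mE' : measurable E'.
  by rewrite /E' -[X in measurable X]setTI; apply: measurable_tuple_cons.
have mp (mu : probability T R) : measurable_fun setT (fun x => iid_law mu n (xsection E' x)).
  exact: measurable_fun_xsection.
have m2 : measurable_fun setT (fun x => (c ^+ 2 * K ^+ n * L x ^+ 2)%:E).
  apply/measurable_EFinP; apply: measurable_funM => //.
  exact: measurable_funX.
rewrite /product_measure1/= mu1E//.
rewrite -ge0_integralZl//=; last 3 first.
- by apply: emeasurable_funM => //; exact/measurable_EFinP.
- by move=> x _; rewrite mule_ge0 ?lee_fin.
- by rewrite lee_fin mulr_ge0.
rewrite [X in _ + X](_ : _ = \int[mu0]_x (c ^+ 2 * K ^+ n * L x ^+ 2)%:E); last first.
  under eq_integral do rewrite EFinM.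
  rewrite ge0_integralZl//.
  - by rewrite LK -EFinM; congr EFin; rewrite (exprSr K) mulrA.
  - by apply/measurable_EFinP; exact: measurable_funX.
  - by move=> x _; rewrite lee_fin sqr_ge0.
  - by rewrite lee_fin mulr_ge0 ?sqr_ge0 ?exprn_ge0.
rewrite -ge0_integralD//=; last first.
  by move=> x _; rewrite lee_fin !mulr_ge0 ?sqr_ge0 ?exprn_ge0.
apply: ge0_le_integral => //=.
- by move=> x _; rewrite !mule_ge0 ?lee_fin ?mulr_ge0.
- apply: emeasurable_funM => //; apply: emeasurable_funM => //.
  exact/measurable_EFinP.
- exact: emeasurable_funD.
move=> x _.
have := IHn (xsection E' x) (c * L x)%R (measurable_xsection x mE') (mulr_ge0 c0 (L0 x)).
rewrite exprMn (_ : (c ^+ 2 * L x ^+ 2 * K ^+ n = c ^+ 2 * K ^+ n * L x ^+ 2)%R); last ring.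
by rewrite mulrA EFinM -muleA [X in _ * X <= _]muleC.
Qed.

(** The inequality holds on each section and is linear in the two measures, so it integrates over
    the common factor [Q]: data with the same law on both sides carry no information. *)
Lemma chi2_close_prod d1 (T1 : measurableType d1) d2 (T2 : measurableType d2)
    (K : R) (P0 P1 : probability T1 R) (Q : probability T2 R) :
  (0 <= K)%R -> chi2_close K P0 P1 -> chi2_close K (P0 \x Q) (P1 \x Q).
Proof.
move=> K0 P01 E c mE c0.
have prodE (P : probability T1 R) : (P \x Q) E = \int[Q]_y P (ysection E y).
  transitivity ((P \x^ Q) E) => //; apply: product_measure_unique => // A B mA mB.
  exact: product_measure2E.
have mp (P : probability T1 R) : measurable_fun setT (fun y => P (ysection E y)).
  exact: measurable_fun_ysection.
rewrite !prodE -ge0_integralZl//=; last by rewrite lee_fin mulr_ge0.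
rewrite [X in _ + X](_ : _ = \int[Q]_y (c ^+ 2 * K)%:E); last first.
  by rewrite integral_cst//= [X in _ * X]probability_setT mule1.
rewrite -ge0_integralD//=; last first.
  by move=> x _; rewrite lee_fin !mulr_ge0 ?sqr_ge0.
apply: ge0_le_integral => //=.
- by move=> y _; rewrite mule_ge0 ?lee_fin ?mulr_ge0.
- by apply: emeasurable_funM.
- exact: emeasurable_funD.
by move=> y _; apply: P01 => //; exact: measurable_ysection.
Qed.

(** Inductive step: (1 + x)(1 - (m + 1) x) = 1 - m x - (m + 1) x^2, which is at most 1 - m x. *)
Lemma expr_inv_bernoulli (x : R) (m : nat) : (0 <= x)%R -> (m%:R * x <= 1)%R ->
  ((1 + x) ^+ m * (1 - m%:R * x) <= 1)%R.
Proof.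
move=> x0; elim: m => [|m IHm] mx; first by rewrite expr0; lra.
rewrite -natr1 in mx *.
have {IHm}: ((1 + x) ^+ m * (1 - m%:R * x) <= 1)%R by apply: IHm; nra.
have : (0 <= (1 + x) ^+ m)%R by rewrite exprn_ge0//; lra.
rewrite exprS; set k := (m%:R)%R; set e := (_ ^+ m)%R.
have k0 : (0 <= k)%R by exact: ler0n.
have kx : (0 <= (k + 1) * (x * x))%R by rewrite !mulr_ge0//; lra.
by move=> e0; have := mulr_ge0 e0 kx; lra.
Qed.

Lemma testing_lower_bound d (T : measurableType d) (P0 P1 : probability T R)
    (A0 A1 : set T) (x : R) (m : nat) :
  (0 <= x)%R -> chi2_close ((1 + x) ^+ m) P0 P1 ->
  measurable A0 -> measurable A1 -> A0 `&` A1 = set0 ->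
  (2 / 3)%:E <= P0 A0 -> (2 / 3)%:E <= P1 A1 ->
  (1 / 4 <= m%:R * x)%R.
Proof.
move=> x0 P01 mA0 mA1 A01 PA0 PA1.
have P0A1 : P0 A1 <= (1 / 3)%:E.
  have : P0 (A0 `|` A1) <= 1 by apply: probability_le1; exact: measurableU.
  have -> : P0 (A0 `|` A1) = P0 A0 + P0 A1 by exact: measureU.
  move: PA0.
  have /fineK <- : P0 A0 \is a fin_num by exact: fin_num_measure.
  have /fineK <- : P0 A1 \is a fin_num by exact: fin_num_measure.
  by rewrite -EFinD !lee_fin; lra.
(* With scale 1/2 the inequality reads 2/3 <= 1/3 + K / 4, so K = (1 + x)^m is at least 4/3; by the
   Bernoulli bound this is impossible when m x < 1/4. *)
have h0 : (0 <= 1 / 2 :> R)%R by lra.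
have := P01 A1 (1 / 2)%R mA1 h0.
move: P0A1 PA1.
have /fineK <- : P1 A1 \is a fin_num by exact: fin_num_measure.
have /fineK <- : P0 A1 \is a fin_num by exact: fin_num_measure.
rewrite -EFinM -EFinD !lee_fin => P0A1 PA1 H.
rewrite leNgt; apply/negP => mx.
have := @expr_inv_bernoulli x m x0.
set e := ((1 + x) ^+ m)%R in H *.
have e4 : (4 / 3 <= e)%R by lra.
by move=> /(_ ltac:(lra)); nra.
Qed.

End testing.

(** * Bounded measurable functions: an algebra on which every expectation exists *)

Definition bmf {R : realType} d (T : measurableType d) (f : T -> R) : Prop :=
  measurable_fun setT f /\ exists C, forall x, `|f x| <= C.

Section bounded_measurable.
Context {R : realType}.

Section ring.
Context d (T : measurableType d).
Implicit Types (f g : T -> R) (P : probability T R).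

Lemma bmf_cst (c : R) : bmf (fun _ : T => c).
Proof. by split => //; exists `|c|. Qed.

Lemma bmfN f : bmf f -> bmf (fun x => - f x).
Proof.
move=> [mf [C fC]]; split; first exact: measurableT_comp.
by exists C => x; rewrite normrN.
Qed.

Lemma bmfD f g : bmf f -> bmf g -> bmf (fun x => f x + g x).
Proof.
move=> [mf [C fC]] [mg [D gD]]; split; first exact: measurable_funD.
by exists (C + D) => x; rewrite (le_trans (ler_normD _ _))// lerD.
Qed.

Lemma bmfB f g : bmf f -> bmf g -> bmf (fun x => f x - g x).
Proof. by move=> ? /bmfN; exact: bmfD. Qed.

Lemma bmfM f g : bmf f -> bmf g -> bmf (fun x => f x * g x).
Proof.
move=> [mf [C fC]] [mg [D gD]]; split; first exact: measurable_funM.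
by exists (C * D) => x; rewrite normrM ler_pM.
Qed.

Lemma bmf_if (b : T -> bool) f g : measurable_fun setT b -> bmf f -> bmf g ->
  bmf (fun x => if b x then f x else g x).
Proof.
move=> mb [mf [C fC]] [mg [D gD]]; split; first exact: measurable_fun_ifT.
exists (Num.max C D) => x; rewrite le_max.
by case: ifP => _; rewrite (fC, gD) ?orbT.
Qed.

Lemma bmf_integrable P f : bmf f -> P.-integrable setT (EFin \o f).
Proof.
move=> [mf [C fC]]; apply: measurable_bounded_integrable => //.
  by rewrite [X in (X < _)%E]probability_setT ltry.
exists C; split; first exact: num_real.
by move=> x Cx y _; apply: le_trans (fC y) _; exact: ltW.
Qed.

Lemma expectD P f g : bmf f -> bmf g ->
  \int[P]_x (f x + g x) = \int[P]_x f x + \int[P]_x g x.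
Proof. by move=> ? ?; rewrite RintegralD//; exact: bmf_integrable. Qed.

Lemma expectB P f g : bmf f -> bmf g ->
  \int[P]_x (f x - g x) = \int[P]_x f x - \int[P]_x g x.
Proof. by move=> ? ?; rewrite RintegralB//; exact: bmf_integrable. Qed.

Lemma expectZ P f (c : R) : bmf f -> \int[P]_x (c * f x) = c * \int[P]_x f x.
Proof. by move=> ?; rewrite RintegralZl//; exact: bmf_integrable. Qed.

Lemma expect_cst P (c : R) : \int[P]_x c = c.
Proof. by rewrite Rintegral_cst//= [X in fine X]probability_setT mulr1. Qed.

Lemma le_expect P f g : bmf f -> bmf g -> (forall x, f x <= g x) ->
  \int[P]_x f x <= \int[P]_x g x.
Proof. by move=> ? ? fg; apply: le_Rintegral => //; exact: bmf_integrable. Qed.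

Lemma eq_expect P f g : f =1 g -> \int[P]_x f x = \int[P]_x g x.
Proof. by move=> fg; apply: eq_Rintegral => x _. Qed.

Lemma expect_EFin P f : bmf f -> (\int[P]_x (f x)%:E = (\int[P]_x f x)%:E)%E.
Proof.
move=> /(bmf_integrable P) iP; rewrite /Rintegral fineK//.
exact: integrable_fin_num.
Qed.

End ring.

Section product.
Context d1 (T1 : measurableType d1) d2 (T2 : measurableType d2).
Variables (P1 : probability T1 R) (P2 : probability T2 R).
Implicit Type f : T1 * T2 -> R.

Lemma bmf_fst (g : T1 -> R) : bmf g -> bmf (fun z : T1 * T2 => g z.1).
Proof. by move=> [mg [C gC]]; split; [exact: measurableT_comp|exists C]. Qed.

Lemma bmf_snd (g : T2 -> R) : bmf g -> bmf (fun z : T1 * T2 => g z.2).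
Proof. by move=> [mg [C gC]]; split; [exact: measurableT_comp|exists C]. Qed.

Lemma bmf_pair1 f x : bmf f -> bmf (fun y => f (x, y)).
Proof.
by move=> [mf [C fC]]; split; [apply: measurableT_comp => //|exists C].
Qed.

Lemma bmf_pair2 f y : bmf f -> bmf (fun x => f (x, y)).
Proof.
by move=> [mf [C fC]]; split; [apply: measurableT_comp => //|exists C].
Qed.

Lemma norm_expect_le d (T : measurableType d) (P : probability T R) (f : T -> R) C :
  bmf f -> (forall x, `|f x| <= C) -> `|\int[P]_x f x| <= C.
Proof.
move=> bf fC; rewrite ler_norml -[X in X <= _ <= _](expect_cst P) -[X in _ <= _ <= X](expect_cst P).
apply/andP; split; apply: le_expect => //; try exact: bmf_cst.
  by move=> x; have := fC x; rewrite ler_norml => /andP[].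
by move=> x; have := fC x; rewrite ler_norml => /andP[].
Qed.

Lemma bmf_expect1 f : bmf f -> bmf (fun x => \int[P2]_y f (x, y)).
Proof.
move=> bf; have [mf [C fC]] := bf; split.
  apply: measurableT_comp => //; apply: (@measurable_fubini_F _ _ _ _ _ P1 P2 (EFin \o f)).
  exact: bmf_integrable.
by exists C => x; apply: norm_expect_le => //; exact: (bmf_pair1 x bf).
Qed.

Lemma bmf_expect2 f : bmf f -> bmf (fun y => \int[P1]_x f (x, y)).
Proof.
move=> bf; have [mf [C fC]] := bf; split.
  apply: measurableT_comp => //; apply: (@measurable_fubini_G _ _ _ _ _ P1 P2 (EFin \o f)).
  exact: bmf_integrable.
by exists C => x; apply: norm_expect_le => //; exact: (bmf_pair2 x bf).
Qed.

Lemma expect_prod1 f : bmf f ->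
  \int[(P1 \x P2)%E]_z f z = \int[P1]_x \int[P2]_y f (x, y).
Proof.
move=> bf; rewrite /Rintegral; congr fine.
rewrite -integral12_prod_meas1; last exact: bmf_integrable.
apply: eq_integral => x _; rewrite fineK//.
by apply: integrable_fin_num => //; apply: bmf_integrable; exact: (bmf_pair1 x bf).
Qed.

Lemma expect_prod2 f : bmf f ->
  \int[(P1 \x P2)%E]_z f z = \int[P2]_y \int[P1]_x f (x, y).
Proof.
move=> bf; rewrite /Rintegral; congr fine.
rewrite -integral21_prod_meas1; last exact: bmf_integrable.
apply: eq_integral => x _; rewrite fineK//.
by apply: integrable_fin_num => //; apply: bmf_integrable; exact: (bmf_pair2 x bf).
Qed.

Lemma expect_swap f : bmf f ->
  \int[P1]_x \int[P2]_y f (x, y) = \int[P2]_y \int[P1]_x f (x, y).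
Proof. by move=> bf; rewrite -expect_prod1// expect_prod2. Qed.

End product.
End bounded_measurable.

(** * Expectations under the uniform law *)

Section uniform_integrals.
Context {R : realType}.
Local Notation leb := (@lebesgue_measure R).

Lemma integral_quadratic (k0 k1 k2 a b : R) : a <= b ->
  \int[leb]_(x in `[a, b]) (k0 + k1 * x + k2 * x ^+ 2) =
  (k0 * b + k1 / 2 * b ^+ 2 + k2 / 3 * b ^+ 3)
  - (k0 * a + k1 / 2 * a ^+ 2 + k2 / 3 * a ^+ 3).
Proof.
rewrite le_eqVlt => /predU1P[->|ab].
  by rewrite set_itv1 Rintegral_set1 subrr.
pose F (x : R) : R := k0 * x + k1 / 2 * x ^+ 2 + k2 / 3 * x ^+ 3.
have dF (x : R) : is_derive x 1 F (k0 + k1 * x + k2 * x ^+ 2).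
  apply: is_derive_eq; rewrite /GRing.scale/=; by field.
have cF : continuous F.
  by move=> x; apply: differentiable_continuous; apply/derivable1_diffP; have [] := dF x.
have cf : continuous (fun x : R => k0 + k1 * x + k2 * x ^+ 2).
  move=> x; apply: differentiable_continuous; apply/derivable1_diffP.
  by have [] : is_derive x 1 (fun x : R => k0 + k1 * x + k2 * x ^+ 2) (k1 + k2 * (2 * x));
    first (apply: is_derive_eq; rewrite /GRing.scale/=; by ring).
rewrite /Rintegral (@continuous_FTC2 _ _ F)//.
- exact: continuous_subspaceT.
- split.
  + by move=> x _; have [] := dF x.
  + by apply: cvg_at_right_filter; exact: cF.
  + by apply: cvg_at_left_filter; exact: cF.
- by move=> x _; rewrite derive1E; have [_ ->] := dF x.
Qed.


Lemma Rintegral_on d (T : measurableType d) (P : probability T R) (D : set T)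
    (f : T -> R) : measurable D -> P D = 1%E -> P.-integrable setT (EFin \o f) ->
  \int[P]_(x in D) f x = \int[P]_x f x.
Proof.
move=> mD PD If.
have PD0 : P (~` D) = 0%E by rewrite probability_setC// PD subee.
rewrite /Rintegral [in RHS](@negligible_integral _ _ _ _ _ (~` D))//.
- by rewrite setTD setCK.
- exact: measurableC.
Qed.

Lemma le_Rintegral_on d (T : measurableType d) (P : probability T R) (D : set T)
    (f g : T -> R) : measurable D -> P D = 1%E ->
  P.-integrable setT (EFin \o f) -> P.-integrable setT (EFin \o g) ->
  (forall x, D x -> f x <= g x) -> \int[P]_x f x <= \int[P]_x g x.
Proof.
move=> mD PD If Ig fg; rewrite -!(Rintegral_on mD PD)//; apply: le_Rintegral => //.
- exact: integrableS If.
- exact: integrableS Ig.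
Qed.

Lemma le_expect_on d (T : measurableType d) (P : probability T R) (D : set T)
    (f g : T -> R) : measurable D -> P D = 1%E -> bmf f -> bmf g ->
  (forall x, D x -> f x <= g x) -> \int[P]_x f x <= \int[P]_x g x.
Proof.
by move=> mD PD bf bg; apply: le_Rintegral_on => //; exact: bmf_integrable.
Qed.

Lemma eq_expect_on d (T : measurableType d) (P : probability T R) (D : set T)
    (f g : T -> R) : measurable D -> P D = 1%E -> bmf f -> bmf g ->
  (forall x, D x -> f x = g x) -> \int[P]_x f x = \int[P]_x g x.
Proof.
move=> mD PD bf bg fg; apply/eqP; rewrite eq_le.
by rewrite !(le_expect_on mD PD)// => x Dx; rewrite fg.
Qed.

(** Adding the bound [C] makes [f] nonnegative, where the hypothesis applies; as [w] has mean 1, the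
    shift cancels. *)
Lemma ge0_expect_weight d (T : measurableType d) (P P' : probability T R)
    (w f : T -> R) :
  (forall g : T -> \bar R, measurable_fun setT g -> (forall x, 0 <= g x)%E ->
    \int[P']_x g x = \int[P]_x (g x * (w x)%:E))%E ->
  bmf w -> bmf f -> \int[P']_x f x = \int[P]_x (w x * f x).
Proof.
move=> PE bw bf; have [mf [C fC]] := bf.
have shift (c : R) : (forall x, 0 <= f x + c) ->
    \int[P']_x (f x + c) = \int[P]_x (w x * (f x + c)).
  move=> fc0; rewrite /Rintegral PE//.
  - by congr fine; apply: eq_integral => x _; rewrite -EFinM mulrC.
  - by apply/measurable_EFinP; exact: measurable_funD.
have w1 : \int[P]_x w x = 1.
  rewrite -(expect_cst P' 1) /Rintegral PE//.
  by congr fine; apply: eq_integral => x _; rewrite mul1e.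
have fC0 x : 0 <= f x + C.
  by have := fC x; rewrite ler_norml => /andP[+ _]; lra.
have := shift C fC0.
rewrite expectD//; last exact: bmf_cst.
under [RHS]eq_expect do rewrite mulrDr.
rewrite expectD; [|exact: bmfM|by apply: bmfM => //; exact: bmf_cst].
under [X in _ = _ + X]eq_expect do rewrite mulrC.
by rewrite expectZ// w1 expect_cst mulr1; exact: addIr.
Qed.

Definition unif_pdf (h x : R) : R := if 0 <= x <= h then h^-1 else 0.

Section uniform.
Variables (h : R) (U : probability (measurableTypeR R) R).
Hypotheses (h0 : 0 < h) (dU : is_density U (unif_pdf h)).

Lemma uniform_supp : U `[0, h]%classic = 1%E.
Proof.
have [_ _ ->//] := dU.
rewrite (eq_integral (fun=> h^-1%:E)); last first.
  by move=> x /set_mem/=; rewrite in_itv/= /unif_pdf => ->.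
rewrite integral_cst//= lebesgue_measure_itv/= lte_fin h0 -EFinB subr0 -EFinM.
by rewrite mulVf ?gt_eqF.
Qed.

(** Discards the endpoint [h], at which the seller's tail integral differs from a difference of
    strict integrals. *)
Lemma uniform_supp_co : U `[0, h[%classic = 1%E.
Proof.
have [_ _ ->//] := dU.
rewrite (eq_integral (fun=> h^-1%:E)); last first.
  move=> x /set_mem/=; rewrite in_itv/= /unif_pdf => /andP[-> xh].
  by rewrite (ltW xh).
rewrite integral_cst//= lebesgue_measure_itv/= lte_fin h0 -EFinB subr0 -EFinM.
by rewrite mulVf ?gt_eqF.
Qed.

Lemma expect_uniform (f : R -> R) : bmf (f : measurableTypeR R -> R) ->
  \int[U]_x f x = h^-1 * \int[leb]_(x in `[0, h]) f x.
Proof.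
move=> bf; have [mf [C fC]] := bf.
have lebfin : (leb `[0%R, h]%classic < +oo)%E.
  by rewrite lebesgue_measure_itv/= lte_fin h0 ltry.
have int (g : R -> R) : bmf (g : measurableTypeR R -> R) -> leb.-integrable (`[0, h]%classic : set R) (EFin \o g).
  move=> [mg [D gD]]; apply: measurable_bounded_integrable => //.
    exact: measurable_funTS.
  exists D; split; first exact: num_real.
  by move=> x Dx y _; apply: le_trans (gD y) _; exact: ltW.
have fC0 x : 0 <= f x + C.
  by have := fC x; rewrite ler_norml => /andP[+ _]; lra.
have : \int[U]_x (f x + C) = h^-1 * \int[leb]_(x in `[0, h]) (f x + C).
  have bfC : bmf (fun x : measurableTypeR R => f x + C).
    by apply: bmfD => //; exact: bmf_cst.
  rewrite -RintegralZl//; last exact: int.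
  rewrite /Rintegral (ge0_integral_density dU)//; last first.
    by apply/measurable_EFinP; case: bfC.
  congr fine; rewrite [RHS]integral_mkcond; apply: eq_integral => x _.
  rewrite -EFinM patchE /unif_pdf mem_setE in_itv/=; case: ifPn => _.
    by rewrite mulrC.
  by rewrite mulr0.
rewrite expectD//; last exact: bmf_cst.
rewrite expect_cst RintegralD//; [|exact: int|by apply: int; exact: bmf_cst].
rewrite Rintegral_cst//= lebesgue_measure_itv/= lte_fin h0 -EFinB/= subr0.
by rewrite mulrDr [X in _ = _ + X]mulrCA mulVf ?gt_eqF// mulr1; exact: addIr.
Qed.

End uniform.

End uniform_integrals.

Section uniform_quadratic.
Context {R : realType}.
Local Notation leb := (@lebesgue_measure R).
Local Notation RR := (measurableTypeR R).
Variables (h : R) (U : probability RR R).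
Hypotheses (h0 : 0 < h) (dU : is_density U (unif_pdf h)).

(** The identity made bounded: it agrees with it on [0, h], which carries all the laws involved. *)
Definition clip (x : RR) : R := if 0 <= x <= h then x else 0.

Lemma measurable_in_itv (i : interval R) : measurable_fun setT (fun x : RR => x \in i).
Proof.
apply: (@measurable_fun_bool _ _ _ _ true); rewrite setTI.
by have := @measurable_itv R i; congr measurable; apply/seteqP; split => x.
Qed.

Lemma bmf_itv (i : interval R) (f g : RR -> R) : bmf f -> bmf g ->
  bmf (fun x : RR => if x \in i then f x else g x).
Proof. by move=> bf bg; apply: bmf_if => //; exact: measurable_in_itv. Qed.

Lemma bmf_clip : bmf clip.
Proof.
split; last first.
  exists h => x; rewrite /clip; case: ifP => [/andP[x0 xh]|_].
    by rewrite ger0_norm.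
  by rewrite normr0 ltW.
apply: measurable_fun_ifT => //.
have := @measurable_in_itv `[0, h].
  by under eq_fun do rewrite in_itv.
Qed.

(** All explicit expectations below are piecewise polynomials of degree at most 2. The flags [s1]
    and [s2] treat open and closed ends at once. *)
Lemma expect_uniform_quadratic (s1 s2 : bool) (a b k0 k1 k2 : R) (g : RR -> R) :
  0 <= a -> a <= b -> b <= h -> bmf g ->
  (forall x, 0 <= x <= h ->
     g x = if x \in Interval (BSide s1 a) (BSide s2 b)
           then k0 + k1 * x + k2 * x ^+ 2 else 0) ->
  \int[U]_x g x = h^-1 * ((k0 * b + k1 / 2 * b ^+ 2 + k2 / 3 * b ^+ 3)
  - (k0 * a + k1 / 2 * a ^+ 2 + k2 / 3 * a ^+ 3)).
Proof.
move=> a0 ab bh bg gE; rewrite (expect_uniform h0 dU)// -integral_quadratic//.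
congr (_ * _); set p := fun x : R => k0 + k1 * x + k2 * x ^+ 2.
set i := Interval _ _ in gE.
have ic : [set` i] `<=` `[a, b]%classic.
  by apply: subset_itv; [case: (s1)|case: (s2)]; rewrite bnd_simp.

have i0h : [set` i] `<=` `[0, h]%classic.
  by apply: subset_trans ic _; apply: subset_itv; rewrite bnd_simp.
have ip (D : set R) : measurable D -> D `<=` `[0, h]%classic -> leb.-integrable D (EFin \o p).
  move=> mD Dh; apply: (@integrableS _ _ _ leb `[0, h]%classic D) => //.
  apply: continuous_compact_integrable; first exact: segment_compact.
  apply: continuous_subspaceT => x; apply: differentiable_continuous.
  apply/derivable1_diffP.
  by have [] : is_derive x 1 p (k1 + k2 * (2 * x));
    first (apply: is_derive_eq; rewrite /GRing.scale/=; by ring).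
transitivity (\int[leb]_(x in `[0, h]) (p \_ [set` i]) x).
  apply: eq_Rintegral => x /set_mem/=; rewrite in_itv/= => xh.
  by rewrite gE// patchE mem_setE.
rewrite -Rintegral_mkcondr setIidr//.
have obnd (s : bool) (y : itv_bound R) : [set` Interval (BSide s a) y] `<=` `[0, h]%classic ->
    \int[leb]_(x in [set` Interval (BSide s a) y]) p x =
    \int[leb]_(x in [set` Interval (BLeft a) y]) p x.
  by case: s => // yh; rewrite Rintegral_itv_obnd_cbnd//; exact: ip.
have ab0h : `[a, b]%classic `<=` `[0, h]%classic.
  by apply: subset_itv; rewrite bnd_simp.
rewrite [LHS]obnd//; case: s2 @i gE ic i0h => // i gE ic i0h.
rewrite Rintegral_itv_bndo_bndc//; apply: ip => //.
by apply: subset_trans ab0h; apply: subset_itv; rewrite bnd_simp.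
Qed.

End uniform_quadratic.

(** * The envelope formula from incentive inequalities *)

Section envelope.
Context {R : realType}.
Local Notation RR := (measurableTypeR R).

(* Halving the interval n times divides the bound by 2^n, as Q telescopes. *)
Lemma constant_by_bisection (H Q : R -> R) (a b : R) : a <= b ->
  (forall x y, a <= x -> x <= y -> y <= b ->
     `|H y - H x| <= (y - x) * (Q y - Q x)) ->
  H b = H a.
Proof.
move=> ab HQ.
have bisect n : forall x y, a <= x -> x <= y -> y <= b ->
    `|H y - H x| <= (y - x) * (Q y - Q x) / 2 ^+ n.
  elim: n => [|n IHn] x y ax xy yb; first by rewrite expr0 divr1; exact: HQ.
  pose z := (x + y) / 2.
  have [xz zy] : x <= z /\ z <= y by rewrite /z; split; lra.
  have h1 := IHn x z ax xz (le_trans zy yb).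
  have h2 := IHn z y (le_trans ax xz) zy yb.
  have -> : H y - H x = (H y - H z) + (H z - H x) by ring.
  apply: le_trans (ler_normD _ _) _; apply: le_trans (lerD h2 h1) _.
  rewrite exprS le_eqVlt; apply/orP; left; apply/eqP; rewrite /z.
  by field; rewrite expf_neq0.
apply/eqP; rewrite -subr_eq0 -normr_le0 leNgt; apply/negP => e0.
pose C := (b - a) * (Q b - Q a).
have C0 : 0 <= C by apply: le_trans (normr_ge0 _) (HQ a b _ _ _).
have [n Cn] : exists n : nat, C / `|H b - H a| < n%:R.
  by exists (Num.truncn (C / `|H b - H a|)).+1; exact: truncnS_gt.
have := bisect n a b (lexx _) ab (lexx _).
rewrite -/C ler_pdivlMr ?exprn_gt0// => le_C.
have n2 : n%:R <= 2 ^+ n :> R by rewrite -natrX ler_nat ltnW// ltn_expl.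
rewrite ltr_pdivrMr// in Cn.
have : n%:R * `|H b - H a| <= `|H b - H a| * 2 ^+ n.
  by rewrite mulrC ler_wpM2l.
by move=> /(lt_le_trans Cn)/lt_le_trans/(_ le_C); rewrite ltxx.
Qed.

Variables (h : R) (U : probability RR R).
Hypotheses (h0 : 0 < h) (dU : is_density U (unif_pdf h)).

Lemma uniform_itv_co (x y : R) : 0 <= x -> x <= y -> y <= h ->
  h * \int[U]_t (if t \in `[x, y[ then 1 else 0) = y - x.
Proof.
move=> x0 xy yh; rewrite (@expect_uniform_quadratic _ h U h0 dU true true x y 1 0 0)//.
- by field; rewrite gt_eqF.
- by apply: bmf_itv; exact: bmf_cst.
- by move=> t _; rewrite !mul0r !addr0.
Qed.

(** Between x and y, both the increment of [u] and the Lebesgue integral of [Q], written [h *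
    \int[U]], lie between (y - x) Q x and (y - x) Q y. Their difference thus satisfies the
    hypothesis of the bisection lemma. *)
Lemma envelope (u Q : RR -> R) : bmf Q ->
  (forall x y, 0 <= x <= h -> 0 <= y <= h -> (y - x) * Q x <= u y - u x) ->
  forall y, 0 <= y <= h ->
  u y = u 0 + h * \int[U]_t (if t < y then Q t else 0).
Proof.
move=> bQ uQ y /andP[y0 yh].
(* Adding the inequalities for (x, t) and (t, x) gives monotonicity of [Q] on [0, h]. *)
have Qnd x t : 0 <= x -> x <= t -> t <= h -> Q x <= Q t.
  move=> x0; rewrite le_eqVlt => /predU1P[->//|xt] th.
  have := uQ x t; have := uQ t x.
  rewrite !(ltW (le_lt_trans x0 xt)) x0 th (ltW (lt_le_trans xt th)) => /(_ erefl erefl) a /(_ erefl erefl) b.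
  have : 0 <= (t - x) * (Q t - Q x) by nra.
  by rewrite pmulr_rge0 ?subr_gt0// subr_ge0.
have blt z : bmf (fun t : RR => if t < z then Q t else 0).
  apply: bmf_if => //; last exact: bmf_cst.
  by apply: measurable_fun_ltr.
pose H x := u x - h * \int[U]_t (if t < x then Q t else 0).
suff : H y = H 0.
  rewrite /H (_ : \int[U]_t (if t < 0 then Q t else 0) = 0); first lra.
  rewrite (eq_expect_on _ (uniform_supp h0 dU) (blt 0) (bmf_cst _ 0))//.
    exact: expect_cst.
  by move=> t /=; rewrite in_itv/= => /andP[t0 _]; rewrite ltNge t0.
apply: (@constant_by_bisection _ Q) => // x z x0 xz zy.
have zh := le_trans zy yh.
have bco (f : RR -> R) : bmf f -> bmf (fun t : RR => if t \in `[x, z[ then f t else 0).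
  by move=> bf; apply: bmf_itv => //; exact: bmf_cst.
have -> : H z - H x =
    (u z - u x) - h * \int[U]_t (if t \in `[x, z[ then Q t else 0).
  rewrite /H (_ : \int[U]_t (if t < z then Q t else 0) =
    \int[U]_t (if t \in `[x, z[ then Q t else 0) +
    \int[U]_t (if t < x then Q t else 0)); first by ring.
  rewrite -expectD//; last exact: bco.
  apply: eq_expect => t; rewrite in_itv/=.
  case: (ltP t x) => tx /=; last by rewrite addr0.
  by rewrite (lt_le_trans tx xz) add0r.
have lo : (z - x) * Q x <= h * \int[U]_t (if t \in `[x, z[ then Q t else 0).
  rewrite -(uniform_itv_co x0 xz zh) -mulrA ler_pM2l// mulrC -expectZ//; last exact: bco (bmf_cst _ _).
  apply: (le_expect_on _ (uniform_supp h0 dU)) => //.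
  - by apply: bmfM; [exact: bmf_cst|exact: bco (bmf_cst _ _)].
  - exact: bco.
  move=> t /=; rewrite !in_itv/= => /andP[t0 th].
  by case: ifP => [/andP[xt tz]|_]; rewrite ?mulr0// mulr1; exact: Qnd.
have hi : h * \int[U]_t (if t \in `[x, z[ then Q t else 0) <= (z - x) * Q z.
  rewrite -(uniform_itv_co x0 xz zh) -mulrA ler_pM2l// [leRHS]mulrC -expectZ//; last exact: bco (bmf_cst _ _).
  apply: (le_expect_on _ (uniform_supp h0 dU)) => //.
  - exact: bco.
  - by apply: bmfM; [exact: bmf_cst|exact: bco (bmf_cst _ _)].
  move=> t /=; rewrite !in_itv/= => /andP[t0 th].
  by case: ifP => [/andP[xt tz]|_]; rewrite ?mulr0// mulr1; apply: Qnd => //; exact: ltW.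
have := uQ x z; have := uQ z x.
rewrite x0 zh (le_trans x0 xz) (le_trans xz zh) => /(_ erefl erefl) a /(_ erefl erefl) b.
by rewrite ler_norml; apply/andP; split; lra.
Qed.

End envelope.

(** * Interim quantities of a mechanism *)

Section virtual_surplus.
Context {R : realType}.
Local Notation RR := (measurableTypeR R).

Section fubini_sections.
Context d1 (T1 : measurableType d1) d2 (T2 : measurableType d2).
Variables (P1 : probability T1 R) (P2 : probability T2 R) (f : T1 * T2 -> R).
Hypothesis If : (P1 \x P2)%E.-integrable setT (EFin \o f).

(** Fubini for payments, which may be unbounded. Integrability of every section makes the inner
    integral finite everywhere, so [fine] loses nothing. *)
Lemma Rintegral_prod1 :
  (forall x, P2.-integrable setT (fun y => (f (x, y))%:E)) ->
  P1.-integrable setT (EFin \o (fun x => \int[P2]_y f (x, y))) /\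
  \int[(P1 \x P2)%E]_z f z = \int[P1]_x \int[P2]_y f (x, y).
Proof.
move=> Ifx.
have FE : fubini_F P2 (EFin \o f) = EFin \o (fun x => \int[P2]_y f (x, y)).
  by apply/funext => x /=; rewrite /Rintegral fineK// integrable_fin_num.
split; first by rewrite -FE; exact: integrable_fubini_F.
rewrite /Rintegral; congr fine; rewrite -integral12_prod_meas1//.
by apply: eq_integral => x _; rewrite FE.
Qed.

Lemma Rintegral_prod2 :
  (forall y, P1.-integrable setT (fun x => (f (x, y))%:E)) ->
  P2.-integrable setT (EFin \o (fun y => \int[P1]_x f (x, y))) /\
  \int[(P1 \x P2)%E]_z f z = \int[P2]_y \int[P1]_x f (x, y).
Proof.
move=> Ify.
have GE : fubini_G P1 (EFin \o f) = EFin \o (fun y => \int[P1]_x f (x, y)).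
  by apply/funext => y /=; rewrite /Rintegral fineK// integrable_fin_num.
have mf : measurable_fun setT (EFin \o f) by exact: measurable_int If.
split.
  rewrite -GE; apply/integrableP; split; first exact: (measurable_fubini_G If).
  apply: le_lt_trans ((integrable21ltyP _ _ mf).1 If).
  apply: ge0_le_integral => //.
  - by apply: measurableT_comp => //; exact: (measurable_fubini_G If).
  - apply: (measurable_fun_fubini_tonelli_G (fun z => `|(EFin \o f) z|%E)) => //.
    exact: measurableT_comp.
  - move=> y _; apply: le_abse_integral => //.
    by have /integrableP[] := Ify y.
rewrite /Rintegral; congr fine; rewrite -integral21_prod_meas1//.
by apply: eq_integral => y _; rewrite GE.
Qed.

End fubini_sections.

Variable h : R.

Definition on_square (g : R -> R -> R) (z : RR * RR) : R :=
  if (0 <= z.1 <= h) && (0 <= z.2 <= h) then g z.1 z.2 else 0.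

Lemma on_squareE (g : R -> R -> R) :
  on_square g = (fun z : RR * RR => g z.1 z.2) \_ (square h).
Proof.
apply/funext => z; rewrite patchE /on_square.
case: ifPn => [/andP[z1 z2]|]; first by rewrite mem_set//; split; rewrite /= in_itv.
by apply: contraNeq; case: ifPn => [/set_mem[]/=|_ /eqP//]; rewrite !in_itv/= => -> ->.
Qed.

Lemma measurable_square : measurable (square h).
Proof. by apply: measurableX; exact: measurable_itv. Qed.

Lemma measurable_on_square (g : R -> R -> R) :
  measurable_fun (square h) (fun z => g z.1 z.2) -> measurable_fun setT (on_square g).
Proof.
move=> mg; rewrite on_squareE; apply: (measurable_restrictT _ measurable_square).1.
exact: mg.
Qed.

Lemma bmf_alloc (M : mechanism h) : bmf (on_square (alloc M)).
Proof.
split; first by apply: measurable_on_square; exact: alloc_measurable.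
exists 1 => z; rewrite /on_square; case: ifP => [/andP[z1 z2]|_].
  by have /andP[q0 q1] := alloc_range M z1 z2; rewrite ger0_norm.
by rewrite normr0.
Qed.

Lemma on_square_alloc_range (M : mechanism h) z : 0 <= on_square (alloc M) z <= 1.
Proof.
rewrite /on_square; case: ifP => [/andP[z1 z2]|_]; last by rewrite lexx ler01.
exact: alloc_range.
Qed.

Lemma Rintegral_square (P1 P2 : probability RR R) (g : R -> R -> R) :
  \int[(P1 \x P2)%E]_(z in square h) g z.1 z.2 = \int[(P1 \x P2)%E]_z on_square g z.
Proof. by rewrite Rintegral_mkcond on_squareE. Qed.

Lemma GFT_expect (DB DS : probability RR R) (M : mechanism h) :
  GFT DB DS M = \int[(DB \x DS)%E]_z
    (on_square (alloc M) z * (clip h z.1 - clip h z.2)).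
Proof.
rewrite /GFT (Rintegral_square _ _ (fun b s => alloc M b s * (b - s))).
apply: eq_Rintegral => z _.
rewrite /on_square /clip; case: ifP => [/andP[-> ->]//|]; by rewrite mul0r.
Qed.

(** For a fixed report the utility is affine in the true type [c], with the interim allocation as
    slope; this turns incentive compatibility into the subgradient inequality of the envelope
    formula. *)
Lemma interim_report1 (P : probability RR R) (M : mechanism h) (c b' : R) :
  0 <= b' <= h -> P.-integrable `[0, h]%classic (fun s => (payB M b' s)%:E) ->
  P.-integrable setT (fun s => (on_square (payB M) (b', s))%:E) /\
  utilB P M c b' = c * \int[P]_s on_square (alloc M) (b', s)
    - \int[P]_s on_square (payB M) (b', s).
Proof.
move=> b'h Ip.
have Ip' : P.-integrable setT (fun s => (on_square (payB M) (b', s))%:E).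
  move/integrable_mkcond : Ip => /(_ (measurable_itv _)).
  congr (_.-integrable _ _); apply/funext => s; rewrite patchE /on_square /= b'h/=.
  by rewrite mem_setE in_itv/=; case: ifP.
split=> //.
have bq := bmf_pair1 b' (bmf_alloc M).
rewrite -expectZ// -RintegralB//; last first.
  by apply: bmf_integrable; apply: bmfM => //; exact: bmf_cst.
rewrite /utilB Rintegral_mkcond; apply: eq_Rintegral => s _.
rewrite patchE /on_square /= b'h/= mem_setE in_itv/=.
by case: ifP => _ //; rewrite mulr0 subr0.
Qed.

Lemma interim_report2 (P : probability RR R) (M : mechanism h) (c s' : R) :
  0 <= s' <= h -> P.-integrable `[0, h]%classic (fun b => (payS M b s')%:E) ->
  P.-integrable setT (fun b => (on_square (payS M) (b, s'))%:E) /\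
  utilS P M c s' = \int[P]_b on_square (payS M) (b, s')
    - c * \int[P]_b on_square (alloc M) (b, s').
Proof.
move=> s'h Ip.
have Ip' : P.-integrable setT (fun b => (on_square (payS M) (b, s'))%:E).
  move/integrable_mkcond : Ip => /(_ (measurable_itv _)).
  congr (_.-integrable _ _); apply/funext => b; rewrite patchE /on_square /= s'h andbT.
  by rewrite mem_setE in_itv/=; case: ifP.
split=> //.
have bq := bmf_pair2 s' (bmf_alloc M).
rewrite -expectZ// -RintegralB//; last first.
  by apply: bmf_integrable; apply: bmfM => //; exact: bmf_cst.
rewrite /utilS Rintegral_mkcond; apply: eq_Rintegral => b _.
rewrite patchE /on_square /= s'h andbT mem_setE in_itv/=.
by case: ifP => _ //; rewrite mulr0 subr0.
Qed.

End virtual_surplus.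

(** * The virtual surplus inequality *)

Section myerson.
Context {R : realType}.
Local Notation RR := (measurableTypeR R).
Variables (h : R) (U DB DS : probability RR R).
Hypotheses (h0 : 0 < h) (dU : is_density U (unif_pdf h)).
Hypotheses (DBh : DB `[0, h]%classic = 1%E) (DSh : DS `[0, h]%classic = 1%E).
Hypotheses (suppB : forall b, 0 <= b <= h -> msupport DB b).
Hypotheses (suppS : forall s, 0 <= s <= h -> msupport DS s).

Lemma bmf_lt (g : RR * RR -> R) : bmf g ->
  bmf (fun z : RR * RR => if z.1 < z.2 then g z else 0).
Proof.
by move=> bg; apply: bmf_if => //; [exact: measurable_fun_ltr|exact: bmf_cst].
Qed.

Lemma bmf_gt (g : RR * RR -> R) : bmf g ->
  bmf (fun z : RR * RR => if z.2 < z.1 then g z else 0).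
Proof.
by move=> bg; apply: bmf_if => //; [exact: measurable_fun_ltr|exact: bmf_cst].
Qed.

Lemma bmf_ge (g : RR * RR -> R) : bmf g ->
  bmf (fun z : RR * RR => if z.2 <= z.1 then g z else 0).
Proof.
by move=> bg; apply: bmf_if => //; [exact: measurable_fun_ler|exact: bmf_cst].
Qed.

Lemma expect_if_mul (P : probability RR R) (b : RR -> bool) (c : R) :
  measurable_fun setT b ->
  \int[P]_x (if b x then c else 0) = c * \int[P]_x (if b x then 1 else 0).
Proof.
move=> mb; rewrite -expectZ; last by apply: bmf_if => //; exact: bmf_cst.
by apply: eq_expect => x; case: ifP; rewrite ?mulr1 ?mulr0.
Qed.

Definition interimB (M : mechanism h) (b : RR) : R :=
  \int[DS]_s on_square h (alloc M) (b, s).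

Definition interimS (M : mechanism h) (s : RR) : R :=
  \int[DB]_b on_square h (alloc M) (b, s).

(** Nonnegative revenue combined with the envelope bounds on interim payments. This is nonnegativity
    of the expected virtual surplus with the densities multiplied out: F_S and 1 - F_B are
    integrated against Lebesgue measure on [0, h], for which [h * \int[U]] stands, so [DB] and [DS]
    may lack densities. *)
Lemma feasible_virtual_surplus (M : mechanism h) : feasible DB DS M ->
  \int[DS]_s (clip h s * interimS M s)
  + h * \int[U]_x (interimS M x * \int[DS]_s (if s <= x then 1 else 0))
  + h * \int[U]_x (interimB M x * \int[DB]_b (if x < b then 1 else 0))
  <= \int[DB]_b (clip h b * interimB M b).
Proof.
case=> ip bic ir wbb; set Q := interimB M; set P := interimS M.
pose q := on_square h (alloc M).
have [IB IS IBs ISb] := ip; have [bicB bicS] := bic; have [irB irS] := ir.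
have bq : bmf q := bmf_alloc M.
have bQ : bmf Q := bmf_expect1 DB DS bq.
have bP : bmf P := bmf_expect2 DB DS bq.
have bc := bmf_clip h0.
pose pB := on_square h (payB M); pose pS := on_square h (payS M).
pose XB b := \int[DS]_s pB (b, s); pose YS s := \int[DB]_b pS (b, s).
have hh : 0 <= h <= h by rewrite lexx ltW.
have h00 : 0 <= (0 : R) <= h by rewrite lexx ltW.
have uBE (c b : R) : 0 <= b <= h -> utilB DS M c b = c * Q b - XB b.
  by move=> bh; have [] := interim_report1 c bh (IBs b bh).
have uSE (c s : R) : 0 <= s <= h -> utilS DB M c s = YS s - c * P s.
  by move=> sh; have [] := interim_report2 c sh (ISb s sh).
pose uB b := b * Q b - XB b; pose vS s := YS s - s * P s.
have envB b : 0 <= b <= h ->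
    XB b <= b * Q b - h * \int[U]_t (if t < b then Q t else 0).
  move=> bh; have := @envelope _ h U h0 dU uB Q bQ.
  have uQ (x y : R) : 0 <= x <= h -> 0 <= y <= h -> (y - x) * Q x <= uB y - uB x.
    move=> xh yh; have := bicB y x (suppB yh) xh.
    by rewrite !uBE// /uB; lra.
  (* Participation is used at the worst types: value 0 for the buyer here, cost [h] for the seller
     below. *)
  move=> /(_ uQ b bh); have := irB 0 (suppB h00); rewrite uBE// -/(uB 0).
  by rewrite {2}/uB; lra.
pose tail s := \int[U]_t (if s <= t then P t else 0).
have envS s : 0 <= s <= h -> YS s >= s * P s + h * tail s.
  move=> sh.
  have vP (x y : R) : 0 <= x <= h -> 0 <= y <= h -> (y - x) * (- P x) <= vS y - vS x.
    move=> xh yh; have := bicS y x (suppS yh) xh.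
    by rewrite !uSE// /vS; lra.
  have := @envelope _ h U h0 dU vS (fun x => - P x) (bmfN bP) vP.
  move=> env; have := env h hh; have := env s sh.
  have := irS h (suppS hh); rewrite uSE// -/(vS h) => vh0.
  suff : \int[U]_t (if t < s then - P t else 0) - \int[U]_t (if t < h then - P t else 0) = tail s.
    move=> e es eh; have : vS s - vS h = h * tail s by rewrite es eh -e; ring.
    by rewrite {1}/vS; lra.
  have blt (z : R) : bmf (fun t : RR => if t < z then - P t else 0).
    apply: bmf_if; [exact: measurable_fun_ltr|exact: bmfN|exact: bmf_cst].
  (* The two integrands differ at [t = h], hence the comparison on the half-open interval. *)
  rewrite -expectB//; apply: (eq_expect_on _ (uniform_supp_co h0 dU)) => //.
  - exact: bmfB.
  - by apply: bmf_if => //; [exact: measurable_fun_ler|exact: bmf_cst].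
  move=> t /=; rewrite in_itv/= => /andP[t0 ->].
  by rewrite leNgt; case: ifP => _ /=; rewrite ?subrr// opprK add0r.
have IpB b : DS.-integrable setT (fun s => (pB (b, s))%:E).
  have [bh|bh] := boolP (0 <= b <= h).
    by have [] := interim_report1 0 bh (IBs b bh).
  rewrite (_ : (fun s => _) = fun=> 0%E); first exact: integrable0.
  by apply/funext => s; rewrite /pB /on_square/= (negbTE bh).
have IpS s : DB.-integrable setT (fun b => (pS (b, s))%:E).
  have [sh|sh] := boolP (0 <= s <= h).
    by have [] := interim_report2 0 sh (ISb s sh).
  rewrite (_ : (fun b => _) = fun=> 0%E); first exact: integrable0.
  by apply/funext => b; rewrite /pS /on_square/= (negbTE sh) andbF.
have IB2 : (DB \x DS)%E.-integrable setT (EFin \o pB).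
  move/integrable_mkcond : IB => /(_ (measurable_square h)).
  by congr (_.-integrable _ _); rewrite /pB on_squareE restrict_EFin.
have IS2 : (DB \x DS)%E.-integrable setT (EFin \o pS).
  move/integrable_mkcond : IS => /(_ (measurable_square h)).
  by congr (_.-integrable _ _); rewrite /pS on_squareE restrict_EFin.
have [IXB XBE] := Rintegral_prod1 IB2 IpB.
have [IYS YSE] := Rintegral_prod2 IS2 IpS.
have RevE : Rev DB DS M = \int[DB]_b XB b - \int[DS]_s YS s.
  rewrite -XBE -YSE -RintegralB//.
  rewrite /Rev (@Rintegral_square _ h _ _ (fun b s => payB M b s - payS M b s)).
  apply: eq_Rintegral => z _; rewrite /pB /pS /on_square.
  by case: ifP; rewrite ?subr0.
move: wbb; rewrite /exante_WBB RevE subr_ge0 => wbb.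
have bltQ : bmf (fun z : RR * RR => if z.2 < z.1 then Q z.2 else 0).
  by apply: bmf_gt; exact: bmf_snd.
have bgeP : bmf (fun z : RR * RR => if z.1 <= z.2 then P z.2 else 0).
  apply: bmf_if; [exact: measurable_fun_ler|exact: bmf_snd|exact: bmf_cst].
have bI1 : bmf (fun b : RR => \int[U]_t (if t < b then Q t else 0)).
  exact: (bmf_expect1 DB U bltQ).
have btail : bmf (tail : RR -> R) by exact: (bmf_expect1 DS U bgeP).
have XB_le : \int[DB]_b XB b <=
    \int[DB]_b (clip h b * Q b) - h * \int[DB]_b \int[U]_t (if t < b then Q t else 0).
  rewrite -expectZ// -expectB; [|exact: bmfM|by apply: bmfM => //; exact: bmf_cst].
  apply: (le_Rintegral_on _ DBh) => //.
    apply: bmf_integrable; apply: bmfB; first exact: bmfM.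
    by apply: bmfM => //; exact: bmf_cst.
  by move=> b /=; rewrite in_itv/= => bh; rewrite /clip bh; exact: envB.
have YS_ge : \int[DS]_s (clip h s * P s) + h * \int[DS]_s tail s <= \int[DS]_s YS s.
  rewrite -expectZ// -expectD; [|exact: bmfM|by apply: bmfM => //; exact: bmf_cst].
  apply: (le_Rintegral_on _ DSh) => //.
    apply: bmf_integrable; apply: bmfD; first exact: bmfM.
    by apply: bmfM => //; exact: bmf_cst.
  by move=> s /=; rewrite in_itv/= => sh; rewrite /clip sh; exact: envS.
(* Exchanging the integrals turns the rent accumulated below b into the tail 1 - F_B. *)
have swapB : \int[DB]_b \int[U]_t (if t < b then Q t else 0) =
    \int[U]_x (Q x * \int[DB]_b (if x < b then 1 else 0)).
  rewrite (expect_swap DB U bltQ); apply: eq_expect => x /=.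
  by rewrite expect_if_mul//; exact: measurable_fun_ltr.
have swapS : \int[DS]_s tail s = \int[U]_x (P x * \int[DS]_s (if s <= x then 1 else 0)).
  rewrite (expect_swap DS U bgeP); apply: eq_expect => x /=.
  by rewrite expect_if_mul//; exact: measurable_fun_ler.
by rewrite -swapB -swapS; lra.
Qed.

End myerson.

(** * Uniform gains from trade of mechanisms feasible under the tilt *)

Section surplus_upper_bound.
Context {R : realType}.
Local Notation RR := (measurableTypeR R).
Variables (h d : R) (U D : probability RR R).
Hypotheses (h0 : 0 < h) (d0 : 0 <= d) (d8 : d <= 1 / 8).
Hypothesis dU : is_density U (unif_pdf h).

(** The likelihood ratio of the tilted law to the uniform one. *)
Definition tilt (b : RR) : R := if b <= h / 2 then 1 - d else 1 + d.

Hypothesis DE : forall g : RR -> R, bmf g -> \int[D]_x g x = \int[U]_x (tilt x * g x).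

Lemma bmf_tilt : bmf tilt.
Proof. by apply: bmf_if; [exact: measurable_fun_ler|exact: bmf_cst|exact: bmf_cst]. Qed.

Lemma bmf_le (c : R) (f : RR -> R) : bmf f -> bmf (fun x : RR => if x <= c then f x else 0).
Proof. by move=> bf; apply: bmf_if => //; [exact: measurable_fun_ler|exact: bmf_cst]. Qed.

Let bc := bmf_clip h0.

(** Half the slack of the constraint, a nonnegative quantity, is added to the objective. In the
    application [V] is the buyer's value from trade, [B] the seller's cost and [W] the buyer's
    information rent; the weight [w] enters the constraint and not the objective. *)
Lemma lagrangian_relaxation d1 (T : measurableType d1) (P : probability T R)
    (w V B W : T -> R) : bmf w -> bmf V -> bmf B -> bmf W ->
  2 * \int[P]_x (w x * B x) + \int[P]_x W x <= \int[P]_x (w x * V x) ->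
  \int[P]_x V x - \int[P]_x B x <=
  \int[P]_x ((V x - B x) + 2^-1 * (w x * V x - 2 * (w x * B x) - W x)).
Proof.
move=> bw bV bB bW VBW.
have bwV := bmfM bw bV; have bwB := bmfM bw bB.
have b2wB := bmfM (bmf_cst T 2) bwB.
have bD := bmfB bwV b2wB; have bDW := bmfB bD bW; have bVB := bmfB bV bB.
rewrite (expectD P bVB (bmfM (bmf_cst T 2^-1) bDW)) (expectZ P 2^-1 bDW).
rewrite (expectB P bV bB) (expectB P bD bW) (expectB P bwV b2wB) (expectZ P 2 bwB).
by rewrite lerDl mulr_ge0 ?invr_ge0// -addrA -opprD subr_ge0.
Qed.

(* The left-hand side is largest for q0 the indicator of [0, c]. *)
Lemma expect_bathtub (q0 : RR -> R) (c : R) : bmf q0 -> (forall s, 0 <= q0 s <= 1) ->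
  c <= h -> \int[U]_s ((c - clip h s) * q0 s) <= if 0 <= c then c ^+ 2 / (2 * h) else 0.
Proof.
move=> bq q01 ch.
have bl : bmf (fun s : RR => (c - clip h s) * q0 s).
  by apply: bmfM => //; apply: bmfB => //; exact: bmf_cst.
case: ifPn => [c0|]; last first.
  rewrite -ltNge => c0; rewrite -(expect_cst U 0).
  apply: (le_expect_on _ (uniform_supp h0 dU)) => //; first exact: bmf_cst.
  move=> s /=; rewrite in_itv/= /clip => sh; rewrite sh.
  by have := q01 s; move: sh => /andP[? ?] /andP[? ?]; nra.
have bg : bmf (fun s : RR => if s <= c then c - clip h s else 0).
  by apply: bmf_le; apply: bmfB => //; exact: bmf_cst.
have -> : c ^+ 2 / (2 * h) = \int[U]_s (if s <= c then c - clip h s else 0).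
  rewrite (@expect_uniform_quadratic _ h U h0 dU true false 0 c c (- 1) 0)//.
    by field; rewrite gt_eqF.
  move=> s sh; rewrite in_itv/= /clip sh; case/andP: (sh) => -> _ /=.
  by case: ifP => // _; ring.
apply: (le_expect_on _ (uniform_supp h0 dU)) => //.
move=> s /=; rewrite in_itv/= /clip => sh; rewrite sh.
have := q01 s => /andP[q0s q1s]; case: ifPn => [sc|]; first nra.
by rewrite -ltNge => cs; nra.
Qed.

Lemma expect_uniform_le (x : R) : 0 <= x <= h ->
  h * \int[U]_s (if s <= x then 1 else 0) = x.
Proof.
move=> /andP[x0 xh].
rewrite (@expect_uniform_quadratic _ h U h0 dU true false 0 x 1 0 0)//.
- by field; rewrite gt_eqF.
- by apply: bmf_le; exact: bmf_cst.
- by move=> s /andP[s0 sh]; rewrite in_itv/= s0 !mul0r !addr0.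
Qed.

Lemma expect_tilt_gt (x : R) : 0 <= x <= h ->
  h * \int[D]_b (if x < b then 1 else 0) =
  if x <= h / 2 then h - (1 - d) * x else (1 + d) * (h - x).
Proof.
move=> /andP[x0 xh].
have blt : bmf (fun b : RR => if x < b then 1 else 0 : R).
  by apply: bmf_if; [exact: measurable_fun_ltr|exact: bmf_cst|exact: bmf_cst].
rewrite DE//.
have btl : bmf (fun b => tilt b * (if x < b then 1 else 0)) by apply: bmfM => //; exact: bmf_tilt.
case: ifPn => [xh2|]; last first.
  rewrite -ltNge => xh2.
  rewrite (@expect_uniform_quadratic _ h U h0 dU false false x h (1 + d) 0 0)//.
    by field; rewrite gt_eqF.
  move=> b /andP[b0 bh]; rewrite in_itv/= bh andbT /tilt !mul0r !addr0.
  case: (ltP x b) => xb; rewrite ?mulr0// mulr1.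
  by rewrite leNgt (lt_trans xh2 xb).
have bi (i : interval R) (c : R) : bmf (fun b : RR => if b \in i then c else 0).
  by apply: bmf_itv; exact: bmf_cst.
rewrite (eq_expect_on (g := fun b : RR => (if b \in `]x, (h / 2)] then 1 - d else 0) +
    (if b \in `](h / 2), h] then 1 + d else 0)) _ (uniform_supp h0 dU))//; last first.
  move=> b /=; rewrite !in_itv/= => /andP[b0 bh]; rewrite bh andbT /tilt.
  case: (ltP (h / 2) b) => hb; case: (ltP x b) => xb /=; rewrite ?mulr1 ?mulr0 ?add0r ?addr0//.
  by have := le_lt_trans xh2 hb; rewrite ltNge xb.
  exact: bmfD.
rewrite expectD//.
rewrite (@expect_uniform_quadratic _ h U h0 dU false false x (h / 2) (1 - d) 0 0)//; last 2 first.
- lra.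
- by move=> b _; rewrite !mul0r !addr0.
rewrite (@expect_uniform_quadratic _ h U h0 dU false false (h / 2) h (1 + d) 0 0)//; last 3 first.
- lra.
- lra.
- by move=> b _; rewrite !mul0r !addr0.
by field; rewrite gt_eqF.
Qed.


Definition interim_cost (M : mechanism h) (b : RR) : R :=
  \int[U]_s (clip h s * on_square h (alloc M) (b, s)).

Lemma bmf_interimB (M : mechanism h) : bmf (interimB U M).
Proof. exact: (bmf_expect1 U U (bmf_alloc M)). Qed.

Lemma bmf_clip_alloc (M : mechanism h) :
  bmf (fun z : RR * RR => clip h z.2 * on_square h (alloc M) z).
Proof. by apply: bmfM; [exact: bmf_snd|exact: bmf_alloc]. Qed.

Lemma bmf_interim_cost (M : mechanism h) : bmf (interim_cost M).
Proof. exact: (bmf_expect1 U U (bmf_clip_alloc M)). Qed.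

Lemma bmf_tail : bmf (fun x : RR => \int[D]_b (if x < b then 1 else 0) : R).
Proof. exact: (bmf_expect1 U D (bmf_lt (bmf_cst _ 1))). Qed.

Lemma GFT_interim (M : mechanism h) : GFT U U M =
  \int[U]_b (clip h b * interimB U M b) - \int[U]_b interim_cost M b.
Proof.
have bq := bmf_alloc M.
pose q := on_square h (alloc M).
have bcc : bmf (fun z : RR * RR => clip h z.1 * q z) := bmfM (bmf_fst RR bc) bq.
transitivity (\int[(U \x U)%E]_z (clip h z.1 * q z - clip h z.2 * q z)).
  by rewrite GFT_expect; apply: eq_expect => z; rewrite mulrC mulrBl.
rewrite (expectB _ bcc (bmf_clip_alloc M)) (expect_prod1 _ _ bcc).
rewrite (expect_prod1 _ _ (bmf_clip_alloc M)); congr (_ - _).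
by apply: eq_expect => b /=; rewrite (expectZ _ _ (bmf_pair1 b bq)).
Qed.

(** Rewrites the seller's cost over the buyer's type, so that constraint and objective become
    integrals in the same variable and can be compared pointwise. *)
Lemma interimS_cost (M : mechanism h) :
  \int[U]_s (clip h s * interimS D M s) = \int[U]_b (tilt b * interim_cost M b).
Proof.
have bq := bmf_alloc M; have bcq := bmf_clip_alloc M.
have bwcq := bmfM (bmf_fst RR bmf_tilt) bcq.
pose q := on_square h (alloc M).
transitivity (\int[U]_s \int[U]_b (tilt b * (clip h s * q (b, s)))).
  apply: eq_expect => s; rewrite /interimS (DE (bmf_pair2 s bq)).
  rewrite -(expectZ U (clip h s) (bmfM bmf_tilt (bmf_pair2 s bq))).
  by apply: eq_expect => b; rewrite mulrCA.
rewrite -(expect_swap U U bwcq); apply: eq_expect => b /=.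
by rewrite (expectZ U (tilt b) (bmf_pair1 b bcq)).
Qed.

(** The factor 2 is the virtual cost 2 s of a uniform seller: since h F_S(x) = x, the seller's rent
    term equals the cost term. *)
Lemma feasible_tilt_constraint (M : mechanism h) :
  (forall b, 0 <= b <= h -> msupport D b) -> (forall s, 0 <= s <= h -> msupport U s) ->
  D `[0, h]%classic = 1%E -> feasible D U M ->
  2 * \int[U]_b (tilt b * interim_cost M b)
  + \int[U]_x (h * (interimB U M x * \int[D]_b (if x < b then 1 else 0)))
  <= \int[U]_b (tilt b * (clip h b * interimB U M b)).
Proof.
move=> suppD suppU Dh feas.
have Uh := uniform_supp h0 dU.
have := feasible_virtual_surplus h0 dU Dh Uh suppD suppU feas.
have bP : bmf (interimS D M) := bmf_expect2 D U (bmf_alloc M).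
have bV : bmf (fun x : RR => \int[U]_b (if b <= x then 1 else 0) : R).
  exact: (bmf_expect1 U U (bmf_ge (bmf_cst _ 1))).
have -> : h * \int[U]_x (interimS D M x * \int[U]_s (if s <= x then 1 else 0)) =
    \int[U]_x (clip h x * interimS D M x).
  have bPV := bmfM bP bV; rewrite -(expectZ U h bPV).
  apply: (eq_expect_on _ Uh (bmfM (bmf_cst _ h) bPV) (bmfM bc bP)) => //.
  move=> x /=; rewrite in_itv/= => xh.
  by rewrite mulrCA (expect_uniform_le xh) /clip xh mulrC.
rewrite interimS_cost -(expectZ U h (bmfM (bmf_interimB M) bmf_tail)).
by rewrite (DE (bmfM bc (bmf_interimB M))) mulr2n mulrDl mul1r.
Qed.

(** The first bound is kept for negative [c] too, where it is crude; this permits a cutoff that does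
    not depend on [d]. *)
Lemma interim_bathtub (M : mechanism h) (b c : R) : c <= h ->
  c * interimB U M b - interim_cost M b <= c ^+ 2 / (2 * h) /\
  (c <= 0 -> c * interimB U M b - interim_cost M b <= 0).
Proof.
move=> ch; have bqb := bmf_pair1 b (bmf_alloc M).
have := expect_bathtub bqb (fun s => on_square_alloc_range M (b, s)) ch.
have -> : \int[U]_s ((c - clip h s) * on_square h (alloc M) (b, s)) =
    c * interimB U M b - interim_cost M b.
  rewrite -(expectZ U c bqb).
  rewrite -(expectB U (bmfM (bmf_cst _ c) bqb) (bmf_pair1 b (bmf_clip_alloc M))).
  by apply: eq_expect => s; rewrite mulrBl.
move=> cQ; split.
  by apply: le_trans cQ _; case: ifP => // _; rewrite divr_ge0 ?sqr_ge0// mulr_ge0// ltW.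
move=> c0; apply: le_trans cQ _; case: ifPn => // c0'.
have -> : c = 0 by apply/eqP; rewrite eq_le c0.
by rewrite expr0n mul0r.
Qed.

(** The two fractions are the gaps b - s at which the Lagrangian integrand changes sign, for b below
    and above h / 2; both equal h / 4 at d = 0. *)
Lemma thresholds : [/\ 2 - d != 0, 2 + d != 0, h != 0,
  h / 4 <= h / (2 * (2 - d)) & 0 <= (1 + d) * h / (2 * (2 + d))].
Proof.
have := d8; have := d0; have := h0 => h_gt0 d_ge0 d_le.
have d2 : 0 < 2 - d by lra.
have d2' : 0 < 2 + d by lra.
split; rewrite ?gt_eqF//.
  have hd : 0 <= h * d by rewrite mulr_ge0// ltW.
  by rewrite ler_pdivlMr ?mulr_gt0//; lra.
by rewrite divr_ge0 ?mulr_ge0 ?(ltW h0) ?(ltW d2')//; lra.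
Qed.

(** Pointwise maximisation: at each b the integrand is (2 - d) or (2 + d) times (b - t) Q b - B b,
    with t the threshold of that half, and the bathtub bound applies with c = b - t. *)
Lemma lagrangian_le (Q B : RR -> R) : bmf Q -> bmf B ->
  (forall b c : R, c <= h -> c * Q b - B b <= c ^+ 2 / (2 * h) /\
     (c <= 0 -> c * Q b - B b <= 0)) ->
  \int[U]_b ((clip h b * Q b - B b) + 2^-1 * (tilt b * (clip h b * Q b)
    - 2 * (tilt b * B b) - h * (Q b * \int[D]_x (if b < x then 1 else 0))))
  <= h * (9 / 64 - d / 320).
Proof.
move=> bQ bB bathtub.
have Uh := uniform_supp h0 dU.
have bcQ := bmfM bc bQ; have bwcQ := bmfM bmf_tilt bcQ.
have b2 := bmfM (bmf_cst _ 2) (bmfM bmf_tilt bB).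
have bW := bmfM (bmf_cst _ h) (bmfM bQ bmf_tail).
have bL := bmfD (bmfB bcQ bB) (bmfM (bmf_cst _ 2^-1) (bmfB (bmfB bwcQ b2) bW)).
have := d8; have := d0; have := h0 => h_gt0 d_ge0 d_le.
have [d2 d2' hn0 ht1 ht2] := thresholds.
set t1 := h / (2 * (2 - d)) in ht1 *; set t2 := (1 + d) * h / (2 * (2 + d)) in ht2 *.
pose quad (a t : R) (b : RR) : R :=
  a * t ^+ 2 / (2 * h) + (- (a * t) / h) * clip h b + a / (2 * h) * (clip h b * clip h b).
have bquad a t : bmf (quad a t).
  apply: bmfD; first by apply: bmfD; [exact: bmf_cst|exact: bmfM (bmf_cst _ _) bc].
  exact: bmfM (bmf_cst _ _) (bmfM bc bc).
have quadE a t b : 0 <= b <= h -> quad a t b = a * ((b - t) ^+ 2 / (2 * h)).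
  by move=> bh; rewrite /quad /clip bh; field.
(* Starting at h / 4 instead of [t1] only enlarges the bound, by a term cubic in [d], and keeps the
   endpoints free of [d]. *)
pose g1 (b : RR) : R := if b \in `](h / 4), (h / 2)] then quad (2 - d) t1 b else 0.
pose g2 (b : RR) : R := if b \in `](h / 2), h] then quad (2 + d) t2 b else 0.
have bg1 : bmf g1 by apply: bmf_itv => //; exact: bmf_cst.
have bg2 : bmf g2 by apply: bmf_itv => //; exact: bmf_cst.
apply: (@le_trans _ _ (\int[U]_b (g1 b + g2 b))).
  apply: (le_expect_on _ Uh bL (bmfD bg1 bg2)); first exact: measurable_itv.
  move=> b /=; rewrite in_itv/= => bh.
  have -> : h * (Q b * \int[D]_x (if b < x then 1 else 0)) = Q b * (if b <= h / 2 then h - (1 - d) * b else (1 + d) * (h - b)).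
    by rewrite -expect_tilt_gt// mulrCA.
  have clipb : clip h b = b by rewrite /clip bh.
  rewrite clipb /tilt /g1 /g2 !in_itv/= !quadE//; move: bh => /andP[b0 bh].
  rewrite bh andbT; case: (leP b (h / 2)) => hb.
    rewrite andbT addr0.
    have -> : b * Q b - B b + 2^-1 * ((1 - d) * (b * Q b) - 2 * ((1 - d) * B b)
        - Q b * (h - (1 - d) * b)) = (2 - d) * ((b - t1) * Q b - B b).
      by rewrite /t1; field.
    have [|up low] := bathtub b (b - t1); first lra.
    case: ifPn => [_|]; first by rewrite ler_pM2l//; lra.
    by rewrite -leNgt => b4; rewrite pmulr_rle0; [apply: low|]; lra.
  rewrite andbF add0r.
  have -> : b * Q b - B b + 2^-1 * ((1 + d) * (b * Q b) - 2 * ((1 + d) * B b)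
      - Q b * ((1 + d) * (h - b))) = (2 + d) * ((b - t2) * Q b - B b).
    by rewrite /t2; field.
  have [|up low] := bathtub b (b - t2); first lra.
  by rewrite ler_pM2l//; lra.
rewrite (expectD U bg1 bg2).
have quad_poly a t b : 0 <= b <= h -> quad a t b =
    a * t ^+ 2 / (2 * h) + (- (a * t) / h) * b + a / (2 * h) * b ^+ 2.
  by move=> bh; rewrite /quad /clip bh expr2.
rewrite (@expect_uniform_quadratic _ h U h0 dU false false (h / 4) (h / 2)
  ((2 - d) * t1 ^+ 2 / (2 * h)) (- ((2 - d) * t1) / h) ((2 - d) / (2 * h)))//; last 4 first.
- lra.
- lra.
- lra.
- by move=> b bh; rewrite /g1; case: ifP => // _; exact: quad_poly.
rewrite (@expect_uniform_quadratic _ h U h0 dU false false (h / 2) h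
  ((2 + d) * t2 ^+ 2 / (2 * h)) (- ((2 + d) * t2) / h) ((2 + d) / (2 * h)))//; last 3 first.
- lra.
- lra.
- by move=> b bh; rewrite /g2; case: ifP => // _; exact: quad_poly.
set X := (X in X <= _).
have -> : X = h * (9 / 64 - d / 192 + d ^+ 2 / (128 * (2 - d)) + d ^+ 2 / (64 * (2 + d))).
  by rewrite /X /t1 /t2; field; rewrite d2 d2' hn0.
rewrite ler_pM2l//.
(* With d <= 1/8 each quadratic term is at most d / 1024, and -1/192 + 2/1024 = -5/1536 is below
   -1/320. *)
have e1 : d ^+ 2 / (128 * (2 - d)) <= d / 1024.
  have dd : 0 <= d * (1 / 8 - d) by rewrite mulr_ge0//; lra.
  by rewrite ler_pdivrMr ?expr2; lra.
have e2 : d ^+ 2 / (64 * (2 + d)) <= d / 1024.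
  have dd : 0 <= d * (1 / 8 - d) by rewrite mulr_ge0//; lra.
  by rewrite ler_pdivrMr ?expr2; lra.
by lra.
Qed.


Lemma GFT_le_of_feasible_tilt (M : mechanism h) :
  (forall b, 0 <= b <= h -> msupport D b) -> (forall s, 0 <= s <= h -> msupport U s) ->
  D `[0, h]%classic = 1%E -> feasible D U M ->
  GFT U U M <= h * (9 / 64 - d / 320).
Proof.
move=> suppD suppU Dh feas; rewrite GFT_interim.
have bQ := bmf_interimB M; have bB := bmf_interim_cost M.
apply: le_trans (lagrangian_relaxation bmf_tilt (bmfM bc bQ) bB
  (bmfM (bmf_cst _ h) (bmfM bQ bmf_tail)) _) _; first exact: feasible_tilt_constraint.
by apply: lagrangian_le => // b c; exact: interim_bathtub.
Qed.

End surplus_upper_bound.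

(** * The wedge mechanism on the uniform law *)

Section second_best_lower_bound.
Context {R : realType}.
Local Notation RR := (measurableTypeR R).
Variables (h : R) (U : probability RR R).
Hypotheses (h0 : 0 < h) (dU : is_density U (unif_pdf h)).

Let bc := bmf_clip h0.

Lemma bmf_wedge (g : RR * RR -> R) : bmf g ->
  bmf (fun z : RR * RR => if h / 4 <= z.1 - z.2 then g z else 0).
Proof.
move=> bg; apply: bmf_if => //; last exact: bmf_cst.
by apply: measurable_fun_ler => //; exact: measurable_funB.
Qed.

Definition wedge_alloc (b s : R) : R := if h / 4 <= b - s then 1 else 0.
(** Critical-value payments: the buyer pays the least value, the seller receives the greatest cost,
    at which trade would still occur. Truth is then dominant. *)
Definition wedge_payB (b s : R) : R := if h / 4 <= b - s then clip h s + h / 4 else 0.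
Definition wedge_payS (b s : R) : R := if h / 4 <= b - s then clip h b - h / 4 else 0.

Lemma bmf_wedge_alloc : bmf (fun z : RR * RR => wedge_alloc z.1 z.2).
Proof. exact: (bmf_wedge (bmf_cst _ 1)). Qed.

Lemma bmf_wedge_payB : bmf (fun z : RR * RR => wedge_payB z.1 z.2).
Proof. exact: (bmf_wedge (bmfD (bmf_snd RR bc) (bmf_cst _ (h / 4)))). Qed.

Lemma bmf_wedge_payS : bmf (fun z : RR * RR => wedge_payS z.1 z.2).
Proof. exact: (bmf_wedge (bmfB (bmf_fst RR bc) (bmf_cst _ (h / 4)))). Qed.

(* For costs and values uniform on [0, h], trading iff the value exceeds the cost
   by h / 4 is second best (Myerson and Satterthwaite). *)
Definition wedge_mechanism : mechanism h.
Proof.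
apply: (@Mechanism R h wedge_alloc wedge_payB wedge_payS).
- by move=> b s _ _; rewrite /wedge_alloc; case: ifP; rewrite ?lexx ?ler01.
- by apply: measurable_funTS; case: bmf_wedge_alloc.
- by apply: measurable_funTS; case: bmf_wedge_payB.
- by apply: measurable_funTS; case: bmf_wedge_payS.
Defined.

Lemma bmf_integrable_on d (T : measurableType d) (P : probability T R) (D : set T)
    (f : T -> R) : measurable D -> bmf f -> P.-integrable D (EFin \o f).
Proof. by move=> mD /(bmf_integrable P); exact: integrableS. Qed.

(** An integrand affine in b - s covers both revenue and gains from trade; 9/32 is the probability
    of trade. *)
Lemma expect_wedge (c k : R) :
  \int[(U \x U)%E]_z on_square h (fun b s =>
    if h / 4 <= b - s then c + k * (clip h b - clip h s) else 0) z =
  9 / 32 * c + 9 / 64 * k * h.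
Proof.
have h_gt0 := h0; have hn0 : h != 0 by rewrite gt_eqF.
have Uh := uniform_supp h0 dU.
have bg : bmf (fun z : RR * RR => if h / 4 <= z.1 - z.2 then
    c + k * (clip h z.1 - clip h z.2) else 0).
  exact: (bmf_wedge (bmfD (bmf_cst _ c)
    (bmfM (bmf_cst _ k) (bmfB (bmf_fst RR bc) (bmf_snd RR bc))))).
have bsq : bmf (on_square h (fun b s =>
    if h / 4 <= b - s then c + k * (clip h b - clip h s) else 0)).
  case: bg => mg [C gC]; split.
    by apply: measurable_on_square; exact: measurable_funTS.
  exists `|C| => z; rewrite /on_square; case: ifP => _; last by rewrite normr0.
  by apply: le_trans (gC z) _; exact: ler_norm.
rewrite (expect_prod1 _ _ bsq).
(* For b >= h / 4 the integral over s equals (k0 + c b + (k / 2) b^2) / h; the terms in k b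
   cancel. *)
pose k0 := - (c * h / 4) - k * h ^+ 2 / 32.
rewrite (@expect_uniform_quadratic _ h U h0 dU true false (h / 4) h (k0 / h) (c / h) (k / 2 / h)); last 5 first.
- lra.
- lra.
- by [].
- exact: (bmf_expect1 U U bsq).
- move=> b /andP[b0 bh]; rewrite in_itv/= bh andbT.
  case: ifPn => b4.
    rewrite (@expect_uniform_quadratic _ h U h0 dU true false 0 (b - h / 4) (c + k * b) (- k) 0); last 5 first.
    + by [].
    + lra.
    + lra.
    + exact: (bmf_pair1 b bsq).
    + move=> s sh; rewrite /on_square/= b0 bh sh in_itv/= /clip b0 bh sh.
      case/andP: sh => -> _ /=; rewrite (_ : (h / 4 <= b - s) = (s <= b - h / 4)).
        by case: ifP => // _; ring.
      by apply/idP/idP; lra.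
    by rewrite /k0; field.
  apply: etrans (expect_cst U 0); apply: (eq_expect_on _ Uh (bmf_pair1 b bsq) (bmf_cst _ 0)) => //.
  move=> s /=; rewrite in_itv/= => sh; rewrite /on_square/= b0 bh sh /=.
  case: ifPn => // bs; exfalso; move/negP: b4; apply.
  by case/andP: sh => s0 _; lra.
by rewrite /k0; field.
Qed.

Lemma wedge_feasible : feasible U U wedge_mechanism.
Proof.
have h_gt0 := h0; have hn0 : h != 0 by rewrite gt_eqF.
have mh : measurable (`[0, h]%classic : set RR) by exact: measurable_itv.
have bB := bmf_wedge_payB; have bS := bmf_wedge_payS; have bA := bmf_wedge_alloc.
have IB b b' : U.-integrable `[0, h]%classic
    (EFin \o (fun s => b * wedge_alloc b' s - wedge_payB b' s)).
  apply: bmf_integrable_on => //; apply: bmfB; last exact: (bmf_pair1 b' bB).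
  exact: (bmfM (bmf_cst _ b) (bmf_pair1 b' bA)).
have IS s s' : U.-integrable `[0, h]%classic
    (EFin \o (fun b => wedge_payS b s' - s * wedge_alloc b s')).
  apply: bmf_integrable_on => //; apply: bmfB; first exact: (bmf_pair2 s' bS).
  exact: (bmfM (bmf_cst _ s) (bmf_pair2 s' bA)).
split.
- split.
  + by apply: bmf_integrable_on; [exact: measurable_square|exact: bB].
  + by apply: bmf_integrable_on; [exact: measurable_square|exact: bS].
  + by move=> b _; apply: bmf_integrable_on => //; exact: (bmf_pair1 b bB).
  + by move=> s _; apply: bmf_integrable_on => //; exact: (bmf_pair2 s bS).
- split=> [b b' _ _|s s' _ _].
  (* Incentive compatibility holds for each opposing type, hence in expectation. *)
  + apply: le_Rintegral => // s /=; rewrite in_itv/= => sh.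
    rewrite /wedge_alloc /wedge_payB /clip sh.
    by case: (lerP (h / 4) (b' - s)) => ?; case: (lerP (h / 4) (b - s)) => ?; lra.
  + apply: le_Rintegral => // b /=; rewrite in_itv/= => bh.
    rewrite /wedge_alloc /wedge_payS /clip bh.
    by case: (lerP (h / 4) (b - s')) => ?; case: (lerP (h / 4) (b - s)) => ?; lra.
- split=> [b _|s _].
  + apply: Rintegral_ge0 => s /=; rewrite in_itv/= => sh.
    rewrite /wedge_alloc /wedge_payB /clip sh.
    by case: (lerP (h / 4) (b - s)) => ?; lra.
  + apply: Rintegral_ge0 => b /=; rewrite in_itv/= => bh.
    rewrite /wedge_alloc /wedge_payS /clip bh.
    by case: (lerP (h / 4) (b - s)) => ?; lra.
rewrite /exante_WBB /Rev.
rewrite (@Rintegral_square _ h _ _ (fun b s => wedge_payB b s - wedge_payS b s)).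
(* Each trade collects h / 2 - (b - s), and b - s has mean h / 2 given trade: the budget balances
   exactly. *)
rewrite (_ : (fun z => on_square _ _ z) = on_square h (fun b s =>
    if h / 4 <= b - s then h / 2 + (-1) * (clip h b - clip h s) else 0)).
  by rewrite expect_wedge; lra.
apply/funext => z; rewrite /on_square /wedge_payB /wedge_payS.
case: ifP => // _; case: ifP => _; last by rewrite subr0.
by field.
Qed.

Lemma GFT_wedge : GFT U U wedge_mechanism = 9 / 64 * h.
Proof.
rewrite GFT_expect (_ : (fun z => _) = on_square h (fun b s =>
    if h / 4 <= b - s then 0 + 1 * (clip h b - clip h s) else 0)).
  by rewrite expect_wedge mulr0 add0r mulr1.
apply/funext => z; rewrite /on_square /= /wedge_alloc.
by case: ifP => // _; [case: ifP|]; rewrite ?mul0r// !mul1r add0r.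
Qed.

Lemma SB_uniform_ge : ((9 / 64 * h)%:E <= @SB R h U U)%E.
Proof.
apply: ereal_sup_ubound; exists wedge_mechanism; first exact: wedge_feasible.
by rewrite GFT_wedge.
Qed.

End second_best_lower_bound.

(** * The tilted law: density, support, regularity *)

Section tilted_uniform.
Context {R : realType}.
Local Notation RR := (measurableTypeR R).
Local Notation leb := (@lebesgue_measure R).
Variables (h d : R).
Hypotheses (h0 : 0 < h) (d0 : 0 <= d) (d8 : d <= 1 / 8).

Definition tilt_pdf (x : R) : R := unif_pdf h x * tilt h d x.

Lemma uniform_density : is_density (uniform_prob h0) (unif_pdf h).
Proof.
have <- : uniform_pdf 0 h = unif_pdf h.
  by apply/funext => x; rewrite /uniform_pdf /unif_pdf subr0.
by split => //; [exact: measurable_uniform_pdf|move=> x; exact: uniform_pdf_ge0].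
Qed.

Lemma tilt_gt0 x : 0 < tilt h d x.
Proof.
by have := d0; have := d8 => ? ?; rewrite /tilt; case: ifP => _; lra.
Qed.

Lemma tilt_pdf_gt0 x : 0 <= x <= h -> 0 < tilt_pdf x.
Proof. by move=> xh; rewrite /tilt_pdf /unif_pdf xh mulr_gt0 ?invr_gt0// tilt_gt0. Qed.

Lemma tilt_pdf_ge0 x : 0 <= tilt_pdf x.
Proof.
rewrite mulr_ge0//; last exact: ltW (tilt_gt0 x).
by rewrite /unif_pdf; case: ifP => // _; rewrite invr_ge0 ltW.
Qed.

Lemma measurable_tilt_pdf : measurable_fun setT (tilt_pdf : RR -> R).
Proof.
apply: measurable_funM; last by case: (@bmf_tilt R h d).
by have [mf _ _] := uniform_density.
Qed.

Section with_uniform.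
Variable U : probability RR R.
Hypothesis dU : is_density U (unif_pdf h).

Lemma expect_step (p q : R) :
  \int[U]_b (if b <= h / 2 then p else q) = (p + q) / 2.
Proof.
have h_gt0 := h0; have hn0 : h != 0 by rewrite gt_eqF.
have bi (i : interval R) (c : R) : bmf (fun b : RR => if b \in i then c else 0).
  by apply: bmf_itv; exact: bmf_cst.
have bs : bmf (fun b : RR => if b <= h / 2 then p else q).
  by apply: bmf_if; [exact: measurable_fun_ler|exact: bmf_cst|exact: bmf_cst].
transitivity (\int[U]_b ((if b \in `[0, (h / 2)] then p else 0) +
    (if b \in `](h / 2), h] then q else 0))).
  apply: (eq_expect_on _ (uniform_supp h0 dU) bs (bmfD (bi _ _) (bi _ _))) => //.
  move=> b /=; rewrite !in_itv/= => /andP[b0 bh]; rewrite b0 bh andbT/=.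
  by case: (leP b (h / 2)) => _; rewrite ?addr0 ?add0r.
rewrite (expectD U (bi _ _) (bi _ _)).
rewrite (@expect_uniform_quadratic _ h U h0 dU true false 0 (h / 2) p 0 0)//; last 3 first.
- lra.
- lra.
- by move=> b _; rewrite !mul0r !addr0.
rewrite (@expect_uniform_quadratic _ h U h0 dU false false (h / 2) h q 0 0)//; last 3 first.
- lra.
- lra.
- by move=> b _; rewrite !mul0r !addr0.
by field.
Qed.

Lemma expect_tilt : \int[U]_b tilt h d b = 1.
Proof. by rewrite expect_step; field. Qed.

Lemma expect_tilt_sqr : \int[U]_b (tilt h d b ^+ 2) = 1 + d ^+ 2.
Proof.
transitivity (\int[U]_b (if b <= h / 2 then (1 - d) ^+ 2 else (1 + d) ^+ 2)).
  by apply: eq_expect => b; rewrite /tilt; case: ifP.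
by rewrite expect_step; field.
Qed.

Lemma integral_tilt_pdf : (\int[leb]_x (tilt_pdf x)%:E = 1)%E.
Proof.
have bt := @bmf_tilt R h d.
transitivity (\int[U]_x (tilt h d x)%:E)%E.
  rewrite (ge0_integral_density dU).
  - by apply: eq_integral => x _; rewrite -EFinM mulrC.
  - by apply/measurable_EFinP; case: bt.
  - by move=> x; rewrite lee_fin ltW// tilt_gt0.
by rewrite (expect_EFin U bt) expect_tilt.
Qed.

Variable D : probability RR R.
Hypothesis dD : is_density D tilt_pdf.

Lemma ge0_integral_tilt (g : RR -> \bar R) :
  measurable_fun setT g -> (forall x, 0 <= g x)%E ->
  (\int[D]_x g x = \int[U]_x (g x * (tilt h d x)%:E))%E.
Proof.
move=> mg g0; have [mt _] := @bmf_tilt R h d.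
rewrite (ge0_integral_density dD)// (ge0_integral_density dU).
- by apply: eq_integral => x _; rewrite -muleA -EFinM mulrC.
- by apply: emeasurable_funM => //; exact/measurable_EFinP.
- by move=> x; rewrite mule_ge0// lee_fin ltW// tilt_gt0.
Qed.

Lemma expect_tilted (g : RR -> R) : bmf g -> \int[D]_x g x = \int[U]_x (tilt h d x * g x).
Proof. by apply: ge0_expect_weight; [exact: ge0_integral_tilt|exact: bmf_tilt]. Qed.

Lemma tilt_supp : D `[0, h]%classic = 1%E.
Proof.
have [_ _ ->//] := dD; rewrite -integral_tilt_pdf [LHS]integral_mkcond.
apply: eq_integral => x _; rewrite patchE mem_setE in_itv/=.
by rewrite /tilt_pdf /unif_pdf; case: (boolP (0 <= x <= h)) => // _; rewrite mul0r.
Qed.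

Lemma msupport_tilt : msupport D = `[0, h]%classic.
Proof.
apply/seteqP; split => x /=.
  move=> Dx; apply: contrapT => xh.
  have oC : open (~` `[0, h]%classic : set R) by rewrite openC; exact: interval_closed.
  have := Dx _ oC xh.
  have mh : measurable (`[0, h]%classic : set RR) by exact: measurable_itv.
  have -> : D (~` `[0, h]%classic) = 0%E.
    by rewrite probability_setC// tilt_supp subee.
  by rewrite ltxx.
rewrite in_itv/= => /andP[x0 xh] V oV Vx.
have /nbhs_ballP[r /= r0 rV] : nbhs x V by exact: open_nbhs_nbhs.
(* Clamping to [0, h] leaves an interval of positive length even when x is an endpoint; the density
   is at least (1 - d) / h on it. *)
pose a := Num.max 0 (x - r / 2); pose b := Num.min h (x + r / 2).
have h_gt0 := h0.
have ab : a < b.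
  by rewrite /a /b gt_max !lt_min; apply/andP; split; apply/andP; split; lra.
have abV : `[a, b]%classic `<=` V.
  move=> y /=; rewrite in_itv/= /a /b ge_max le_min => /andP[/andP[_ ya] /andP[_ yb]].
  by apply: rV; rewrite /ball/= ltr_norml; apply/andP; split; lra.
have abh y : `[a, b]%classic y -> 0 <= y <= h.
  rewrite /= in_itv/= /a /b ge_max le_min => /andP[/andP[y0 _] /andP[yh _]].
  by rewrite y0.
have mab : measurable (`[a, b]%classic : set RR) by exact: measurable_itv.
have mV : measurable (V : set RR) by exact: open_measurable.
apply: (@lt_le_trans _ _ (D `[a, b]%classic)); last by apply: le_measure; rewrite ?inE.
have [_ _ ->//] := dD.
pose c := (1 - d) / h.
have c0 : 0 < c by rewrite divr_gt0// ; have := d8; lra.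
apply: (@lt_le_trans _ _ (\int[leb]_(y in `[a, b]) c%:E)%E).
  rewrite integral_cst//= lebesgue_measure_itv/= lte_fin ab -EFinB -EFinM lte_fin.
  by rewrite mulr_gt0// subr_gt0.
apply: ge0_le_integral => //.
- by move=> y _; rewrite lee_fin ltW.
- by apply/measurable_EFinP/measurable_funTS; exact: measurable_tilt_pdf.
move=> y aby; rewrite lee_fin /tilt_pdf /unif_pdf abh// /c mulrC ler_pM2l ?invr_gt0//.
by rewrite /tilt; have := d0; case: ifP => _; lra.
Qed.

Lemma cdf_tilt x : 0 <= x <= h ->
  1 - cdf_of D x = if x <= h / 2 then 1 - (1 - d) * x / h else (1 + d) * (h - x) / h.
Proof.
move=> xh; have h_gt0 := h0; have hn0 : h != 0 by rewrite gt_eqF.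
have bl : bmf (fun b : RR => if b <= x then 1 else 0 : R) by apply: bmf_le; exact: bmf_cst.
have bg : bmf (fun b : RR => if x < b then 1 else 0 : R).
  by apply: bmf_if; [exact: measurable_fun_ltr|exact: bmf_cst|exact: bmf_cst].
have -> : cdf_of D x = \int[D]_b (if b <= x then 1 else 0).
  rewrite cdf_ofE; have mx : measurable (`]-oo, x]%classic : set RR) by exact: measurable_itv.
  rewrite /Rintegral -[X in D X]setIT -integral_indic//; congr fine.
  apply: eq_integral => b _; rewrite indicE mem_setE in_itv/=.
  by case: ifP.
have := @expect_tilt_gt R h d U D h0 dU expect_tilted x xh.
have -> : \int[D]_b (if b <= x then 1 else 0) = 1 - \int[D]_b (if x < b then 1 else 0).
  rewrite -[X in X - _](expect_cst D) -(expectB D (bmf_cst _ 1) bg).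
  by apply: eq_expect => b; case: (leP b x) => _; rewrite ?subr0 ?subrr.
rewrite subKr => e; apply: (mulfI hn0); rewrite e.
by case: ifP => _; field.
Qed.

Lemma admissible_tilt : admissible h D tilt_pdf.
Proof.
split; [exact: tilt_supp| |exact: dD|].
  by rewrite msupport_tilt; exact: interval_is_interval.
by move=> x /interior_subset; rewrite msupport_tilt /= in_itv/=; exact: tilt_pdf_gt0.
Qed.

Lemma phiB_tilt x : 0 <= x <= h ->
  phiB D tilt_pdf x = if x <= h / 2 then 2 * x - h / (1 - d) else 2 * x - h.
Proof.
move=> xh; have h_gt0 := h0; have hn0 : h != 0 by rewrite gt_eqF.
have := d0; have := d8 => d_le d_ge.
have d1 : 1 - d != 0 by rewrite gt_eqF//; lra.
have d1' : 1 + d != 0 by rewrite gt_eqF//; lra.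
rewrite /phiB (cdf_tilt xh) /tilt_pdf /unif_pdf xh /tilt.
by case: ifP => _; field; rewrite hn0 ?d1 ?d1'.
Qed.

(** Each half has slope 2, and at h / 2 the virtual value jumps by h / (1 - d) - h >= 0. A downward
    jump of the density would break this. *)
Lemma phiB_tilt_nondecreasing : nondecreasing_inside D (phiB D tilt_pdf).
Proof.
move=> x y /interior_subset + /interior_subset +.
rewrite msupport_tilt /= !in_itv/= => xh yh xy.
rewrite !phiB_tilt//; case: ifPn => x2; case: ifPn => y2.
- by lra.
- have hd : h <= h / (1 - d).
    have := h0; have := d0; have := d8 => ? ? ?.
    by rewrite ler_pdivlMr; nra.
  by lra.
- by exfalso; move/negP: x2; apply; exact: le_trans xy y2.
- by lra.
Qed.

End with_uniform.
End tilted_uniform.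

(** * The two hard instances and the conclusion *)

Section hard_pair.
Context {R : realType}.
Local Notation RR := (measurableTypeR R).
Variables (h d : R) (U D : probability RR R).
Hypotheses (h0 : 0 < h) (d0 : 0 <= d) (d8 : d <= 1 / 8).
Hypotheses (dU : is_density U (unif_pdf h)) (dD : is_density D (tilt_pdf h d)).

Let zero_le : 0 <= 0 :> R. Proof. exact: lexx. Qed.
Let zero_le8 : 0 <= 1 / 8 :> R. Proof. by lra. Qed.

(** Makes the uniform law the case d = 0, so that the facts on tilted laws serve for both
    instances. *)
Lemma tilt_pdf0 : tilt_pdf h 0 = unif_pdf h.
Proof.
by apply/funext => x; rewrite /tilt_pdf /tilt subr0 addr0; case: ifP; rewrite mulr1.
Qed.

Let dU0 : is_density U (tilt_pdf h 0).
Proof. by rewrite tilt_pdf0. Qed.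

Lemma msupport_uniform : msupport U = `[0, h]%classic.
Proof. exact: (msupport_tilt h0 zero_le zero_le8 dU dU0). Qed.

Lemma regular_tilt : regular h D U.
Proof.
exists (tilt_pdf h d), (unif_pdf h); split.
- exact: (admissible_tilt h0 d0 d8 dU dD).
- by rewrite -tilt_pdf0; exact: (admissible_tilt h0 zero_le zero_le8 dU dU0).
- exact: (phiB_tilt_nondecreasing h0 d0 d8 dU dD).
have hn0 : h != 0 by rewrite gt_eqF.
have phiSE x : 0 <= x <= h -> phiS U (unif_pdf h) x = 2 * x.
  move=> xh; have := cdf_tilt h0 zero_le zero_le8 dU dU0 xh.
  rewrite subr0 addr0 !mul1r /phiS /unif_pdf xh => cdfE.
  have -> : cdf_of U x = x / h.
    rewrite -[LHS](subKr 1) cdfE; case: ifP => _; first by rewrite subKr.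
    by field.
  by field.
move=> x y /interior_subset + /interior_subset +.
by rewrite msupport_uniform /= !in_itv/= => xh yh xy; rewrite !phiSE// ler_pM2l.
Qed.

(** Uniform gains from trade would be at least 9 h / 64 - eps and at most 9 h / 64 - h d / 320. *)
Lemma not_good_both (eps : R) (M : mechanism h) :
  320 * eps < h * d -> good U U eps M -> feasible D U M -> False.
Proof.
move=> dk [_ SBM] feas.
have suppD b : 0 <= b <= h -> msupport D b.
  by move=> bh; rewrite (msupport_tilt h0 d0 d8 dU dD)/= in_itv.
have suppU s : 0 <= s <= h -> msupport U s.
  by move=> sh; rewrite msupport_uniform/= in_itv.
have := GFT_le_of_feasible_tilt h0 d0 d8 dU (expect_tilted d0 d8 dU dD) suppD suppU
  (tilt_supp h0 d0 d8 dU dD) feas.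
have := le_trans (leeB (SB_uniform_ge h0 dU) (lexx eps%:E)) SBM.
rewrite -EFinB lee_fin => lo hi.
have {lo hi} : 9 / 64 * h - eps <= h * (9 / 64 - d / 320) := le_trans lo hi.
by rewrite mulrBr [h * (9 / 64)]mulrC mulrA lerD2l lerN2 ler_pdivrMr ?ltr0n// [eps * _]mulrC leNgt dk.
Qed.

Lemma chi2_close_samples d' (T : measurableType d') (P : probability T R) (m : nat) :
  chi2_close ((1 + d ^+ 2) ^+ m) ((iid_law U m \x iid_law U m) \x P)%E
    ((iid_law D m \x iid_law U m) \x P)%E.
Proof.
have K0 : 0 <= 1 + d ^+ 2 by rewrite addr_ge0 ?sqr_ge0.
have Km0 : 0 <= (1 + d ^+ 2) ^+ m by rewrite exprn_ge0.
apply: chi2_close_prod => //; apply: chi2_close_prod => //.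
have bt := @bmf_tilt R h d.
apply: (@chi2_close_iid _ _ _ U D (tilt h d)) => //.
- by case: bt.
- by move=> x; exact: ltW (tilt_gt0 h d0 d8 x).
- by move=> g mg g0; exact: (ge0_integral_tilt d0 d8 dU dD).
have := expect_EFin U (bmfM bt bt); under eq_integral do rewrite -expr2.
by move=> ->; rewrite -(expect_tilt_sqr d h0 dU); congr EFin; apply: eq_expect => x.
Qed.

End hard_pair.

Theorem theorem3p7 (R : realType) :
  exists c0 c1 : R, [/\ 0 < c0, 0 < c1 &
    forall h eps : R, 0 < h -> 0 < eps <= c1 * h ->
    forall (m : nat) (d : measure_display) (T : measurableType d)
      (P : probability T R) (L : learner T m h),
    (forall DB DS : probability (measurableTypeR R) R,
        regular h DB DS -> succeeds P eps L DB DS) ->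
    c0 * (h ^+ 2 / eps ^+ 2) <= m%:R].
Proof.
(* With d = k eps / h, any k above 320 makes the loss exceed eps. The bound eps <= h / (8 k) gives d
   <= 1/8, and m d^2 >= 1/4 becomes m >= h^2 / (2 k eps)^2. *)
have [k k320] : exists k : R, 320 < k by exists (320 + 1); rewrite ltrDl.
have k0 : 0 < k by apply: lt_trans k320; rewrite ltr0n.
have k2 : 0 < k ^+ 2 by rewrite exprn_gt0.
have c00 : 0 < ((2 * k) ^+ 2)^-1 by rewrite invr_gt0 exprn_gt0// mulr_gt0.
have c10 : 0 < (8 * k)^-1 by rewrite invr_gt0 mulr_gt0.
exists ((2 * k) ^+ 2)^-1, (8 * k)^-1; split=> //.
move=> h eps h0 /andP[eps0 eps_le] m disp T P L succ.
pose d := k * eps / h.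
have d0 : 0 <= d by rewrite divr_ge0 ?mulr_ge0// ltW.
have d8 : d <= 1 / 8.
  move: eps_le; rewrite /d [X in _ <= X -> _]mulrC ler_pdivlMr ?mulr_gt0// ler_pdivrMr//.
  by lra.
have dk : 320 * eps < h * d.
  by rewrite /d mulrCA mulfV ?gt_eqF// mulr1 ltr_pM2r.
pose U : probability (measurableTypeR R) R := uniform_prob h0.
have dU : is_density U (unif_pdf h) := uniform_density h0.
have [D dD] : exists D : probability (measurableTypeR R) R, is_density D (tilt_pdf h d).
  apply: exists_density; first exact: measurable_tilt_pdf.
  - exact: (tilt_pdf_ge0 h0 d0 d8).
  - exact: (integral_tilt_pdf h0 d0 d8 dU).
have dU0 : is_density U (tilt_pdf h 0) by rewrite tilt_pdf0.
have [A0 [mA0 goodA0 PA0]] : succeeds P eps L U U.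
  by apply: succ; apply: (@regular_tilt _ h 0) => //; lra.
have [A1 [mA1 goodA1 PA1]] : succeeds P eps L D U.
  by apply: succ; exact: (@regular_tilt _ h d).
have A01 : A0 `&` A1 = set0.
  (* Samples and seed [w] fix a single output of the learner, which cannot serve both instances. *)
  apply/seteqP; split => // w [/goodA0 g0 /goodA1 [feas _]].
  exact: (not_good_both h0 d0 d8 dU dD dk g0 feas).
have := testing_lower_bound (sqr_ge0 d)
  (@chi2_close_samples _ h d U D h0 d0 d8 dU dD _ _ P m) mA0 mA1 A01 PA0 PA1.
have -> : d ^+ 2 = k ^+ 2 * (eps ^+ 2 / h ^+ 2) by rewrite /d expr_div_n exprMn mulrA.
rewrite -[h ^+ 2 / _]invf_div -invfM; set X := eps ^+ 2 / h ^+ 2 => mX.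
have X0 : 0 < X by rewrite divr_gt0 ?exprn_gt0.
have -> : (2 * k) ^+ 2 * X = 4 * (k ^+ 2 * X) by ring.
rewrite -[_^-1]mul1r ler_pdivrMr; last by rewrite mulr_gt0// mulr_gt0.
by rewrite mulrCA; lra.
Qed.
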